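(* Let $1\le k\le n$, and let $\mathcal P_1,\dots,\mathcal P_k$ and $\mathcal Q_1,\dots,\mathcal Q_k$ be real functions in $C^\infty(\mathbb{R}^n)$ such that the systems $\mathcal P_i(x)=0$ ($i=1,\dots,k$) and $\mathcal Q_i(x)=0$ ($i=1,\dots,k$) define the same $(n-k)$-dimensional surface $\mathbb S\subset\mathbb{R}^n$, and such that $$\mathcal Q_i(x)=\sum_{j=1}^k\mathcal P_j(x)\alpha_{ji}(x),\qquad \mathcal P_i(x)=\sum_{j=1}^k\mathcal Q_j(x)\beta_{ji}(x),$$ where $\alpha_{ij},\beta_{ij}\in C^\infty(\mathbb{R}^n)$ satisfy $\sum_i\alpha_{ji}\beta_{ik}=\delta_{jk}$ and $\sum_i\beta_{ji}\alpha_{ik}=\delta_{jk}$. Assume that the families of surfaces $\mathcal P_i(x)=\mathrm{const}$ and $\mathcal Q_i(x)=\mathrm{const}$ each form a correct grid. Then for every integer $s\ge0$ and all indices $i_1,\dots,i_s\in\{1,\dots,k\}$ the following equality of distributions holds: $$\delta_{i_1\cdots i_s}(\mathcal Q)=(\det\beta)\sum_{j_1,\dots,j_s=1}^k\beta_{i_1j_1}\cdots\beta_{i_sj_s}\,\delta_{j_1\cdots j_s}(\mathcal P),$$ where $\beta=(\beta_{ij})$.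
   Context: Distributions concentrated on smooth surfaces are understood in the sense of Gelfand and Shilov. The surfaces $\mathcal P_i=\mathrm{const}$ form a correct grid if, in a neighbourhood of each point of $\mathbb S$, the functions $\mathcal P_1,\dots,\mathcal P_k$ can be completed to a smooth local coordinate system $u_1=\mathcal P_1,\dots,u_k=\mathcal P_k,u_{k+1},\dots,u_n$ (i.e. $d\mathcal P_1,\dots,d\mathcal P_k$ are linearly independent on $\mathbb S$). Fix an orientation of $\mathbb S$, the same for both systems of equations. For a test function $\varphi$ supported in such a neighbourhood write $\varphi\,dx_1\wedge\cdots\wedge dx_n=\tilde\varphi(u)\,du_1\wedge\cdots\wedge du_n$ (so $\tilde\varphi$ includes the signed Jacobian). The generalized function $\delta(\mathcal P)=\delta(\mathcal P_1,\dots,\mathcal P_k)$ and its derivatives $$\delta_{i_1\cdots i_s}(\mathcal P)=\frac{\partial^s}{\partial\mathcal P_{i_1}\cdots\partial\mathcal P_{i_s}}\,\delta(\mathcal P_1,\dots,\mathcal P_k)$$ are defined by $$\langle\delta_{i_1\cdots i_s}(\mathcal P),\varphi\rangle=(-1)^s\int_{\mathbb S}\left.\frac{\partial^s\tilde\varphi}{\partial u_{i_1}\cdots\partial u_{i_s}}\right|_{u_1=\dots=u_k=0}du_{k+1}\wedge\cdots\wedge du_n,$$ and for general test functions by a partition of unity; the result does not depend on the choice of $u_{k+1},\dots,u_n$. For $s=0$ this is $\delta(\mathcal P)$ itself. The distributions $\delta_{i_1\cdots i_s}(\mathcal Q)$ are defined in the same way from $\mathcal Q_1,\dots,\mathcal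 Q_k$ with the same orientation of $\mathbb S$. Products of smooth functions with distributions are the usual ones. *)

(* Defs.v *)
From HB Require Import structures.
From mathcomp Require Import all_boot all_order all_algebra.
From mathcomp Require Import all_classical all_reals all_analysis.

Set Implicit Arguments.
Unset Strict Implicit.
Unset Printing Implicit Defensive.
Import Order.TTheory GRing.Theory Num.Theory.
Import numFieldNormedType.Exports.
Local Open Scope classical_set_scope.
Local Open Scope ring_scope.

(* Points of R^n are row vectors.  In the codimension k situation the ambient
   space is 'rV[R]_(k + m), so that n = k + m and m = n - k is the dimension of
   the surface. *)

Section smooth_functions.
Context {R : realType} {n : nat}.
Implicit Types (U : set 'rV[R]_n) (f phi : 'rV[R]_n -> R).

(* partials [:: i1; ...; is] f is d^s f / dx_i1 ... dx_is. *)
Definition partials (e : seq 'I_n) f : 'rV[R]_n -> R :=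
  foldr (fun (i : 'I_n) (g : 'rV[R]_n -> R) => 'D_(delta_mx 0 i) g) f e.

(* Meant for open U. *)
Definition smooth_on U f : Prop :=
  forall (e : seq 'I_n) (x : 'rV[R]_n), U x ->
    {for x, continuous (partials e f)} /\
    forall i : 'I_n, derivable (partials e f) x (delta_mx 0 i).

Definition smooth_mx_on (p q : nat) U (F : 'rV[R]_n -> 'M[R]_(p, q)) : Prop :=
  forall i j, smooth_on U (fun x => F x i j).

Definition supp f : set 'rV[R]_n := closure [set x | f x != 0].

Definition test_function phi : Prop :=
  smooth_on setT phi /\ compact (supp phi).

End smooth_functions.

Section distributions.
Context {R : realType} {n : nat}.

(* A functional is only looked at on test functions; two distributions T and T'
   are equal when T phi = T' phi for every test function phi. *)
Definition functional := ('rV[R]_n -> R) -> R.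
Implicit Type T : functional.

Definition is_distribution T : Prop :=
  (forall (a : R) (phi psi : 'rV[R]_n -> R),
     test_function phi -> test_function psi ->
     T (fun x => a * phi x + psi x) = a * T phi + T psi) /\
  (forall K : set 'rV[R]_n, compact K ->
     exists (C : R) (N : nat), forall (phi : 'rV[R]_n -> R) (M : R),
       test_function phi -> supp phi `<=` K ->
       (forall (e : seq 'I_n) x,
          (size e <= N)%N -> `|partials e phi x| <= M) ->
       `|T phi| <= C * M).

Definition fmul (a : 'rV[R]_n -> R) T : functional :=
  fun phi => T (fun x => a x * phi x).

End distributions.
Arguments functional : clear implicits.

(* The integral over R^m, as an iterated Lebesgue integral; it is only applied
   to continuous functions with compact support. *)
Fixpoint integral_rV (R : realType) (m : nat) : ('rV[R]_m -> R) -> R :=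
  match m return ('rV[R]_m -> R) -> R with
  | 0%N => fun f => f 0
  | m'.+1 => fun f =>
      \int[@lebesgue_measure R]_t
         integral_rV (fun y : 'rV[R]_m' => f (row_mx (t%:M : 'rV[R]_1) y))
  end.

Section oriented_surfaces.
Context {R : realType} {n : nat}.

Definition tangent (S : set 'rV[R]_n) (p v : 'rV[R]_n) : Prop :=
  exists c : R -> 'rV[R]_n,
    [/\ c 0 = p, \forall t \near (0 : R), S (c t),
        derivable c 0 1 & 'D_1 c 0 = v].

(* The rows of A form a basis of the tangent space at p of the m-dimensional
   surface S. *)
Definition tangent_frame (m : nat) (S : set 'rV[R]_n) (p : 'rV[R]_n)
    (A : 'M[R]_(m, n)) : Prop :=
  row_free A /\ forall i : 'I_m, tangent S p (row i A).

(* An orientation gives the sign, +1 or -1, of every tangent frame.  When m = 0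
   the only frame at p is the empty one, and an orientation is an assignment of
   signs to the points of S. *)
Record orientation (m : nat) (S : set 'rV[R]_n) := Orientation {
  frame_sign :> 'rV[R]_n -> 'M[R]_(m, n) -> R;
  frame_sign_pm1 : forall p A, S p -> tangent_frame S p A ->
    frame_sign p A = 1 \/ frame_sign p A = -1;
  frame_sign_mul : forall p A (B : 'M[R]_m),
    S p -> tangent_frame S p A -> B \in unitmx ->
    frame_sign p (B *m A) = Num.sg (\det B) * frame_sign p A;
  frame_sign_continuous : forall (V : set 'rV[R]_n)
      (A : 'rV[R]_n -> 'M[R]_(m, n)), open V ->
    {within S `&` V, continuous A} ->
    (forall p, (S `&` V) p -> tangent_frame S p (A p)) ->
    {within S `&` V, continuous (fun p => frame_sign p (A p))}
}.

End oriented_surfaces.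

Section delta.
Context {R : realType} {k m : nat}.
Implicit Types (S : set 'rV[R]_(k + m)) (P : 'rV[R]_(k + m) -> 'rV[R]_k)
  (phi : 'rV[R]_(k + m) -> R).

(* A smooth local coordinate system u = chart_map on the open set chart_dom,
   whose first k coordinates are P_1, ..., P_k; chart_inv is x as a function
   of u. *)
Record adapted_chart P := AdaptedChart {
  chart_dom : set 'rV[R]_(k + m);
  chart_map : 'rV[R]_(k + m) -> 'rV[R]_(k + m);
  chart_inv : 'rV[R]_(k + m) -> 'rV[R]_(k + m);
  chart_dom_open : open chart_dom;
  chart_cod_open : open (chart_map @` chart_dom);
  chart_map_smooth : smooth_mx_on chart_dom chart_map;
  chart_inv_smooth : smooth_mx_on (chart_map @` chart_dom) chart_inv;
  chart_mapK : forall x, chart_dom x -> chart_inv (chart_map x) = x;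
  chart_adapted : forall x, chart_dom x -> lsubmx (chart_map x) = P x
}.

Definition correct_grid S P : Prop :=
  forall p, S p -> exists c : adapted_chart P, chart_dom c p.

(* phi dx_1 ... dx_n = in_chart c phi (u) du_1 ... du_n, extended by 0 outside
   the range of the chart.  The rows of 'J (chart_inv c) u are the vectors
   dx/du_1, ..., dx/du_n. *)
Definition in_chart P (c : adapted_chart P) phi : 'rV[R]_(k + m) -> R :=
  patch (fun=> 0) (chart_map c @` chart_dom c)
    (fun u => phi (chart_inv c u) * \det ('J (chart_inv c) u)).

(* The local formula, for phi supported in chart_dom c.  The factor o makes
   (u_(k+1), ..., u_n) |-> x(0, ..., 0, u_(k+1), ..., u_n) integrate over S with
   the given orientation: it is the sign of the coordinate frame
   dx/du_(k+1), ..., dx/du_n, and may differ between components of S inside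
   the chart. *)
Definition delta_in_chart S (o : orientation m S) P (c : adapted_chart P)
    (e : seq 'I_k) phi : R :=
  (-1) ^+ size e *
  integral_rV (fun y : 'rV[R]_m =>
    let u : 'rV[R]_(k + m) := row_mx 0 y in
    o (chart_inv c u) (dsubmx ('J (chart_inv c) u)) *
    partials (map (lshift m) e) (in_chart c phi) u).

(* T is delta_(e_1 ... e_s)(P), with S = {P = 0} oriented by o.  The functions
   rho_a form a partition of unity near the part of S met by the support of
   phi, each supported in a coordinate neighbourhood. *)
Definition is_delta S (o : orientation m S) P (e : seq 'I_k)
    (T : functional R (k + m)) : Prop :=
  is_distribution T /\
  forall phi, test_function phi ->
  forall (N : nat) (c : 'I_N -> adapted_chart P)
      (rho : 'I_N -> 'rV[R]_(k + m) -> R) (V : set 'rV[R]_(k + m)),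
    (forall a, test_function (rho a) /\ supp (rho a) `<=` chart_dom (c a)) ->
    open V -> S `&` supp phi `<=` V ->
    (forall x, V x -> \sum_(a < N) rho a x = 1) ->
    T phi = \sum_(a < N)
              delta_in_chart o (c a) e (fun x => rho a x * phi x).

End delta.

(* Main.v *)
Require Import Defs.
From HB Require Import structures.
From mathcomp Require Import all_boot all_order all_algebra.
From mathcomp Require Import all_classical all_reals all_analysis.
From mathcomp Require Import ring lra.

Set Implicit Arguments.
Unset Strict Implicit.
Unset Printing Implicit Defensive.
Import Order.TTheory GRing.Theory Num.Theory.
Import numFieldNormedType.Exports.
Local Open Scope classical_set_scope.
Local Open Scope ring_scope.

(* Choose near a point of S a chart u of P and a chart v of Q with the same
   tangential coordinates on S.  The field X = d/dv_l has, in the coordinates u,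
   normal components b_la + sum_j u_j C_ja with C = a X(b), because u = v b on
   the first k coordinates.  By the Piola identity, d/dv_l of the pulled-back
   density F is the pull-back of div (X F), and on S the Jacobian of u with
   respect to v is det b.  Since X(det b) = det b tr C, one is left with the
   operator H |-> div (X H) - tr C H acting on H = det b F; iterating it gives
   sum_J d_J (b_IJ H) up to terms that vanish on S and tangential divergences,
   which integrate to 0 over S.  A partition of unity globalizes the result. *)

(** * Smooth functions on open subsets of R^n *)

(** The defining formula of delta is available in every adapted chart, so the two charts can be
    chosen to induce the same parametrization of S. Both sides then become integrals over one plane
    of tangential coordinates, and no change of variables in an integral is made: linearity, a sup
    bound and the vanishing of the integral of a tangential derivative suffice. The weights beta
    stand outside delta_J(P), hence multiply the test function before it is differentiated; this is
    why the induction carries sum_J d_J (b_IJ H) and not sum_J b_IJ d_J H. The obstacle is that a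
    normal derivative of a term vanishing on S need not vanish there. The induction therefore proves
    an exact identity on the whole open set, with the factors u_j kept visible. Applying d_c to u_j
    G_cj releases G_cc; these extra terms cancel against those coming from b_ic div (X H) = div (X
    b_ic H) - X(b_ic) H, and the cancellation is precisely b C = X(b). *)

Section partial_derivatives.
Context {R : realType}.

Lemma is_derive_line (V : normedModType R) (f : V -> R) (y v : V) (t : R) :
  derivable f (t *: v + y) v ->
  is_derive t 1 (fun s : R => f (s *: v + y)) ('D_v f (t *: v + y)).
Proof.
move=> df.
have E : (fun h : R => h^-1 *: (((fun s : R => f (s *: v + y)) \o shift t) (h *: 1) -
    f (t *: v + y))) = (fun h => h^-1 *: ((f \o shift (t *: v + y)) (h *: v) -
    f (t *: v + y))).
  apply/funext => h /=; congr (_ *: (f _ - _)).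
  by rewrite [h *: 1]mulr1 scalerDl addrA.
by split; [rewrite /derivable E|rewrite /derive E].
Qed.

(** Recording only [|c| <= |a|] covers steps of either sign, which is the form that the later ball
    estimates need. *)
Lemma MVT_line (V : normedModType R) (f : V -> R) (y v : V) (a : R) :
  (forall t : R, `|t| <= `|a| -> derivable f (t *: v + y) v) ->
  exists2 c, `|c| <= `|a| & f (a *: v + y) - f y = a * 'D_v f (c *: v + y).
Proof.
move=> df; pose g (t : R) := f (t *: v + y).
have dg (t : R) : `|t| <= `|a| -> is_derive t 1 g ('D_v f (t *: v + y)).
  by move=> ta; apply: is_derive_line; exact: df.
have cg (u w : R) : (forall t : R, t \in `[u, w] -> `|t| <= `|a|) ->
    {within `[u, w], continuous g}.
  move=> uw; apply: derivable_within_continuous => t /uw ta.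
  by have [] := dg _ ta.
have [a0|a0] := leP 0 a.
  have itvP (t : R) : t \in `[0, a] -> `|t| <= `|a|.
    by rewrite in_itv/= => /andP[t0 ta]; rewrite !ger0_norm.
  have [||c /itvP ca E] := @MVT_segment R g (fun t => 'D_v f (t *: v + y)) 0 a a0.
  - move=> t; rewrite in_itv/= => /andP[t0 ta]; apply: dg.
    by rewrite !ger0_norm// ltW.
  - exact: cg.
  exists c => //; move: E; rewrite /g scale0r add0r subr0 => ->.
  by rewrite mulrC.
have itvP (t : R) : t \in `[a, 0] -> `|t| <= `|a|.
  rewrite in_itv/= => /andP[t0 ta]; rewrite !ler0_norm ?lerN2//.
  exact: ltW.
have [||c /itvP ca E] := @MVT_segment R g (fun t => 'D_v f (t *: v + y)) a 0 (ltW a0).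
- move=> t; rewrite in_itv/= => /andP[t0 ta]; apply: dg.
  apply: itvP; rewrite in_itv/=; apply/andP; split; exact: ltW.
- exact: cg.
exists c => //; move: E; rewrite /g scale0r add0r => E.
by rewrite -opprB E; ring.
Qed.

Lemma differentiable_of_expansion (V W : normedModType R) (f : V -> W)
    (df : {linear V -> W}) (x : V) :
  continuous df -> f \o shift x = cst (f x) + df +o_ 0 id ->
  differentiable f x.
Proof.
move=> dfc E; have dE := diff_unique dfc E.
by apply/diff_locallyP; rewrite dE.
Qed.

Definition pd n (i : 'I_n) (f : 'rV[R]_n -> R) : 'rV[R]_n -> R :=
  fun x => 'D_(delta_mx 0 i) f x.

Lemma entry_le_norm n (h : 'rV[R]_n) (j : 'I_n) : `|h 0 j| <= `|h|.
Proof.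
rewrite [leRHS]/Num.Def.normr/= mx_normrE.
exact: (le_bigmax _ (fun ij : 'I_1 * 'I_n => `|h ij.1 ij.2|) (0, j)).
Qed.

Lemma norm_le_entries n (h : 'rV[R]_n) (M : R) : 0 <= M ->
  (forall j, `|h 0 j| <= M) -> `|h| <= M.
Proof.
move=> M0 hM; rewrite [leLHS]/Num.Def.normr/= mx_normrE.
by apply: bigmax_le => // -[i j] _; rewrite ord1.
Qed.

Definition gradient_dot n (f : 'rV[R]_n -> R) (x h : 'rV[R]_n) : R :=
  \sum_i h 0 i * pd i f x.

Lemma gradient_dot_linear n (f : 'rV[R]_n -> R) x : linear (gradient_dot f x).
Proof.
move=> a u v; rewrite /gradient_dot scaler_sumr -big_split/=.
by apply: eq_bigr => i _; rewrite !mxE mulrDl -mulrA.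
Qed.

HB.instance Definition _ n (f : 'rV[R]_n -> R) x :=
  GRing.isLinear.Build R 'rV[R]_n R _ (gradient_dot f x)
    (gradient_dot_linear f x).

Lemma gradient_dot_continuous n (f : 'rV[R]_n -> R) x :
  continuous (gradient_dot f x).
Proof.
apply: (continuous_big (op := +%R)) => [|i _ h]; first exact: add_continuous.
apply: (@continuousM R _ (fun h : 'rV[R]_n => h 0 i) (cst (pd i f x)) h).
  exact: coord_continuous.
exact: cst_continuous.
Qed.

(** The increment of f is split into n moves parallel to the axes. The mean value theorem turns each
    into an entry of h times a partial derivative at a point near x, and continuity replaces that
    derivative by its value at x. *)
Lemma differentiable_C1 n (f : 'rV[R]_n -> R) (x : 'rV[R]_n) :
  (\forall y \near x, forall i, derivable f y (delta_mx 0 i)) ->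
  (forall i, {for x, continuous (pd i f)}) -> differentiable f x.
Proof.
move=> nd cd; apply: (@differentiable_of_expansion _ _ f (gradient_dot f x)).
  exact: gradient_dot_continuous.
apply/eqaddoP => _/posnumP[e].
(* Each of the n moves may err by [e' * |h|]; dividing by [n.+1] instead of n also covers n = 0. *)
pose e' := e%:num / n.+1%:R.
have e'0 : 0 < e' by rewrite divr_gt0.
have : \forall y \near x, (forall i, derivable f y (delta_mx 0 i)) /\
    forall i, `|pd i f x - pd i f y| <= e'.
  have cd' (i : 'I_n) : \forall y \near x, `|pd i f x - pd i f y| <= e'.
    by have /cvgrPdist_le /(_ _ e'0) := cd i.
  exact: (filterI nd (filter_forall _ cd')).
move=> /nbhs_ballP[d /= d0 dP]; apply/nbhs_ballP; exists d => //= h.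
rewrite -ball_normE /ball_/= sub0r normrN => hd.
(* [p k] keeps the first k entries of h, so [p k + x] follows an axis-parallel path from x to h +
   x. *)
pose p (k : nat) : 'rV[R]_n := \row_j (if (j < k)%N then h 0 j else 0).
have p0 : p 0%N = 0 by apply/rowP => j; rewrite !mxE ltn0.
have pn : p n = h by apply/rowP => j; rewrite !mxE ltn_ord.
have pS (k : 'I_n) : p k.+1 = h 0 k *: delta_mx 0 k + p k.
  apply/rowP => j; rewrite !mxE eqxx/= ltnS leq_eqVlt.
  case: (altP (j =P k)) => [->|jk]; first by rewrite eqxx/= ltnn mulr1 addr0.
  by rewrite -val_eqE/= in jk; rewrite (negbTE jk)/= mulr0 add0r.
have pnear (k : 'I_n) (t : R) : `|t| <= `|h 0 k| ->
    ball x d (t *: delta_mx 0 k + (p k + x)).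
  move=> th; rewrite -ball_normE /ball_/= distrC addrA addrK.
  apply: le_lt_trans hd; apply: norm_le_entries => // j.
  rewrite !mxE eqxx/=.
  case: (altP (j =P k)) => [->|jk].
    by rewrite ltnn mulr1 addr0 (le_trans th)// entry_le_norm.
  rewrite mulr0 add0r; case: ifP => _; first exact: entry_le_norm.
  by rewrite normr0.
have tele : f (h + x) - f x = \sum_(k < n) (f (p k.+1 + x) - f (p k + x)).
  have := @telescope_sumr R 0 n (fun k => f (p k + x)) (leq0n _).
  by rewrite big_mkord pn p0 add0r => <-.
rewrite -[X in `|X|]/(f (h + x) - (f x + gradient_dot f x h)) opprD addrA tele.
rewrite /gradient_dot -sumrB.
apply: (@le_trans _ _ (\sum_(k < n) `|h| * e')).
  apply: (le_trans (ler_norm_sum _ _ _)); apply: ler_sum => k _.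
  have [t th|c hc] := @MVT_line _ f (p k + x) (delta_mx 0 k) (h 0 k).
    by have [+ _] := dP _ (pnear k t th).
  rewrite pS -[_ *: _ + _ + x]addrA => ->; rewrite -mulrBr normrM.
  apply: ler_pM => //; first exact: entry_le_norm.
  by have [_ /(_ k)] := dP _ (pnear k c hc); rewrite distrC.
rewrite -mulr_sumr sumr_const card_ord mulrC ler_wpM2r// -mulr_natr /e'.
by rewrite -mulrA ger_pMr// mulrC ler_pdivrMr ?mul1r ?ler_nat.
Qed.

End partial_derivatives.

Section pd_rules.
Context {R : realType} {n : nat}.
Implicit Types (f g : 'rV[R]_n -> R) (x : 'rV[R]_n) (U : set 'rV[R]_n).

Lemma open_near U x : open U -> U x -> \forall y \near x, U y.
Proof. by move=> oU Ux; exact: open_nbhs_nbhs. Qed.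

Lemma near_pd i f g x : {near x, f =1 g} -> pd i f x = pd i g x.
Proof. exact: near_eq_derive. Qed.

Lemma near_differentiable (V W : normedModType R) (f g : V -> W) (x : V) :
  {near x, f =1 g} -> differentiable f x -> differentiable g x.
Proof.
move=> fg df; have fgx : f x = g x by exact: nbhs_singleton fg.
have [cdf E] := (diff_locallyP _ _).1 df.
apply: (@differentiable_of_expansion _ _ _ _ ('d f x) x cdf).
apply/eqaddoP => _/posnumP[e].
move/eqaddoP : E => /(_ e%:num) /(_ [gt0 of e%:num]) E.
have fg0 : \forall h \near (0 : V), f (h + x) = g (h + x).
  by move: fg; rewrite (near_shift 0) /=; apply: filterS => h; rewrite /= subr0.
move: fg0 E; apply: filterS2 => h fgh; rewrite -fgx.
by rewrite -![(_ + _ : _ -> _) _]/(_ + _) -![(- _ : _ -> _) _]/(- _) /= fgh.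
Qed.

Lemma pd_ext U i f g : open U -> (forall x, U x -> f x = g x) ->
  forall x, U x -> pd i f x = pd i g x.
Proof.
by move=> oU fg x Ux; apply: near_pd; apply: filterS (open_near oU Ux).
Qed.

Lemma pdD i f g x : differentiable f x -> differentiable g x ->
  pd i (fun y => f y + g y) x = pd i f x + pd i g x.
Proof. by move=> df dg; rewrite /pd deriveD//; exact: diff_derivable. Qed.

Lemma pdN i f x : differentiable f x -> pd i (fun y => - f y) x = - pd i f x.
Proof. by move=> df; rewrite /pd deriveN//; exact: diff_derivable. Qed.

Lemma pdM i f g x : differentiable f x -> differentiable g x ->
  pd i (fun y => f y * g y) x = pd i f x * g x + f x * pd i g x.
Proof.
move=> df dg; rewrite /pd deriveM; [|exact: diff_derivable..].
by rewrite ![_ *: _]mulrC [f x * _]mulrC addrC [_ * f x]mulrC.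
Qed.

Lemma pd_cst i (c : R) x : pd i (fun=> c) x = 0.
Proof. exact: derive_cst. Qed.

Lemma differentiable_bigsum (I : Type) (r : seq I) (F : I -> 'rV[R]_n -> R) x :
  (forall a, differentiable (F a) x) ->
  differentiable (fun y => \sum_(a <- r) F a y) x.
Proof.
move=> dF; elim: r => [|a r IH].
  under eq_fun do rewrite big_nil; exact: differentiable_cst.
under eq_fun do rewrite big_cons.
exact: differentiableD.
Qed.

Lemma pd_sum i (I : Type) (r : seq I) (F : I -> 'rV[R]_n -> R) x :
  (forall a, differentiable (F a) x) ->
  pd i (fun y => \sum_(a <- r) F a y) x = \sum_(a <- r) pd i (F a) x.
Proof.
move=> dF; elim: r => [|a r IH].
  by under eq_fun do rewrite big_nil; rewrite pd_cst big_nil.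
under eq_fun do rewrite big_cons.
rewrite pdD// ?big_cons ?IH//; exact: differentiable_bigsum.
Qed.

Lemma pd_coord i j x : pd i (fun y => y 0 j) x = (i == j)%:R.
Proof.
rewrite /pd deriveE; last exact: differentiable_coord.
have @c : {linear 'rV[R]_n -> R}.
  by exists (fun N : 'rV[R]_n => N 0 j); do 2![eexists]; do ?[constructor];
     rewrite ?mxE// => ? *; rewrite ?mxE//; move=> ?; rewrite !mxE.
rewrite (_ : (fun y : 'rV[R]_n => y 0 j) = c)// diff_lin; last first.
  exact: coord_continuous.
by rewrite /= mxE eqxx/= eq_sym.
Qed.

Lemma pdV i f x : differentiable f x -> f x != 0 ->
  pd i (fun y => (f y)^-1) x = - (f x) ^- 2 * pd i f x.
Proof. by move=> df f0; rewrite /pd deriveV//; exact: diff_derivable. Qed.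

Lemma differentiable_row (p : nat) (V : normedModType R) (g : V -> 'rV[R]_p) (x : V) :
  (forall j, differentiable (fun y => g y 0 j) x) -> differentiable g x.
Proof.
move=> dg; rewrite (_ : g = fun y => \sum_j g y 0 j *: delta_mx 0 j); last first.
  by apply/funext => y; rewrite -row_sum_delta.
rewrite -fct_sumE; apply: differentiable_sum => j.
exact: differentiableZl.
Qed.

Lemma pd_comp (p : nat) i (f : 'rV[R]_p -> R) (g : 'rV[R]_n -> 'rV[R]_p) x :
  differentiable f (g x) -> (forall j, differentiable (fun y => g y 0 j) x) ->
  pd i (fun y => f (g y)) x = \sum_j pd j f (g x) * pd i (fun y => g y 0 j) x.
Proof.
move=> df dg; have dgx := differentiable_row dg.
rewrite /pd (@deriveE _ _ _ (f \o g)); last exact: differentiable_comp.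
rewrite diff_comp//=.
have -> : 'd g x (delta_mx 0 i) =
    \sum_j 'D_(delta_mx 0 i) (fun y => g y 0 j) x *: delta_mx 0 j.
  rewrite -deriveE// derive_mx; last exact: diff_derivable.
  by rewrite [LHS]row_sum_delta; apply: eq_bigr => j _; rewrite mxE.
rewrite linear_sum; apply: eq_bigr => j _.
by rewrite linearZ [RHS]mulrC (deriveE _ df).
Qed.

End pd_rules.

Section smooth_calculus.
Context {R : realType}.

Lemma near_continuous (T T' : topologicalType) (f g : T -> T') (x : T) :
  {near x, f =1 g} -> {for x, continuous f} -> {for x, continuous g}.
Proof.
move=> fg cf; have cfx : f y @[y --> x] --> f x := cf.
suff : g y @[y --> x] --> g x by [].
rewrite -(nbhs_singleton fg); apply: cvg_trans cfx.
exact: near_eq_cvg.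
Qed.

Lemma continuous_mx (T : topologicalType) p q (g : T -> 'M[R]_(p, q)) (x : T) :
  (forall i j, {for x, continuous (fun y => g y i j)}) ->
  {for x, continuous g}.
Proof.
move=> cg A /= [B nB sB].
have nBj (j : 'I_p * 'I_q) : \forall y \near x, B j.1 j.2 (g y j.1 j.2).
  exact: cg (nB j.1 j.2).
have H := filter_forall (nbhs_filter x) nBj.
exact: (filterS (fun y By => sB (g y) (fun i j => By (i, j))) H).
Qed.

(** [smooth_on] speaks only of iterated coordinate derivatives, a form unsuited to the chain rule.
    [Ck] asks for full differentiability at each order below r, which allows induction on r for
    sums, products, inverses and compositions. *)
Fixpoint Ck n (r : nat) (U : set 'rV[R]_n) (f : 'rV[R]_n -> R) : Prop :=
  match r with
  | 0 => forall x, U x -> {for x, continuous f}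
  | r'.+1 => (forall x, U x -> differentiable f x) /\
             forall i, Ck r' U (pd i f)
  end.

Lemma Ck_ext n r (U : set 'rV[R]_n) f g : open U ->
  (forall x, U x -> f x = g x) -> Ck r U f -> Ck r U g.
Proof.
move=> oU; elim: r f g => [|r IH] f g fg /=.
  move=> cf x Ux; apply: near_continuous (cf _ Ux).
  by apply: filterS (open_near oU Ux) => y Uy; rewrite fg.
move=> [df cf]; split=> [x Ux|i].
  apply: near_differentiable (df _ Ux).
  by apply: filterS (open_near oU Ux) => y Uy; rewrite fg.
by apply: IH (cf i); exact: pd_ext.
Qed.

Lemma CkW n r (U : set 'rV[R]_n) f : Ck r.+1 U f -> Ck r U f.
Proof.
elim: r f => [|r IH] f [df cf]; first by move=> x /df; exact: differentiable_continuous.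
by split=> // i; exact: IH.
Qed.

Lemma Ck_cst n r (U : set 'rV[R]_n) (c : R) : Ck r U (fun=> c).
Proof.
elim: r c => [|r IH] c; first by move=> x _; exact: cst_continuous.
split=> [x _|i]; first exact: differentiable_cst.
by rewrite (_ : pd i _ = fun=> 0)//; apply/funext => x; exact: pd_cst.
Qed.

Lemma Ck_coord n r (U : set 'rV[R]_n) j : Ck r U (fun x => x 0 j).
Proof.
case: r => [|r]; first by move=> x _; exact: coord_continuous.
split=> [x _|i]; first exact: differentiable_coord.
rewrite (_ : pd i _ = fun=> (i == j)%:R); first exact: Ck_cst.
by apply/funext => x; exact: pd_coord.
Qed.

Lemma CkD n r (U : set 'rV[R]_n) f g : open U ->
  Ck r U f -> Ck r U g -> Ck r U (fun x => f x + g x).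
Proof.
move=> oU; elim: r f g => [|r IH] f g.
  by move=> cf cg x Ux; apply: continuousD; [exact: cf|exact: cg].
move=> [df cf] [dg cg]; split=> [x Ux|i].
  by apply: differentiableD; [exact: df|exact: dg].
apply: (Ck_ext oU) (IH _ _ (cf i) (cg i)) => x Ux.
by rewrite pdD//; [exact: df|exact: dg].
Qed.

Lemma CkM n r (U : set 'rV[R]_n) f g : open U ->
  Ck r U f -> Ck r U g -> Ck r U (fun x => f x * g x).
Proof.
move=> oU; elim: r f g => [|r IH] f g.
  by move=> cf cg x Ux; apply: continuousM; [exact: cf|exact: cg].
move=> Cf Cg; have [[df cf] [dg cg]] := (Cf, Cg); split=> [x Ux|i].
  by apply: differentiableM; [exact: df|exact: dg].
apply: (Ck_ext oU) (CkD oU (IH _ _ (cf i) (CkW Cg)) (IH _ _ (CkW Cf) (cg i))) => x Ux.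
by rewrite pdM//; [exact: df|exact: dg].
Qed.

Lemma Ck_sum n r (U : set 'rV[R]_n) (I : Type) (s : seq I) F : open U ->
  (forall a, Ck r U (F a)) -> Ck r U (fun x => \sum_(a <- s) F a x).
Proof.
move=> oU cF; elim: s => [|a s IH].
  by under eq_fun do rewrite big_nil; exact: Ck_cst.
by under eq_fun do rewrite big_cons; exact: CkD.
Qed.

Lemma CkV n r (U : set 'rV[R]_n) f : open U -> (forall x, U x -> f x != 0) ->
  Ck r U f -> Ck r U (fun x => (f x)^-1).
Proof.
move=> oU f0; elim: r => [|r IH] Cf.
  by move=> x Ux; apply: continuousV; [exact: f0|exact: Cf].
have [df cf] := Cf; split=> [x Ux|i].
  by apply: differentiableV; [exact: df|exact: f0].
have CV := IH (CkW Cf).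
apply: (Ck_ext oU) (CkM oU (Ck_cst r U (- 1))
  (CkM oU (CkM oU CV CV) (cf i))) => x Ux.
by rewrite pdV; [rewrite mulN1r mulNr -invfM expr2|exact: df|exact: f0].
Qed.

Lemma Ck_comp n p r (U : set 'rV[R]_n) (V : set 'rV[R]_p) f
    (g : 'rV[R]_n -> 'rV[R]_p) : open U ->
  (forall x, U x -> V (g x)) -> Ck r V f ->
  (forall j, Ck r U (fun x => g x 0 j)) -> Ck r U (fun x => f (g x)).
Proof.
move=> oU UV; elim: r f => [|r IH] f Cf Cg.
  move=> x Ux; apply: (@continuous_comp _ _ _ g f); last exact/Cf/UV.
  by apply: continuous_mx => a j; rewrite ord1; exact: Cg.
have [df cf] := Cf; split=> [x Ux|i].
  apply: (@differentiable_comp _ _ _ _ g f); last exact/df/UV.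
  by apply: differentiable_row => j; have [dg _] := Cg j; exact: dg.
have C1 : Ck r U (fun x => \sum_j pd j f (g x) * pd i (fun y => g y 0 j) x).
  apply: Ck_sum => // j; apply: CkM => //; last by have [_ /(_ i)] := Cg j.
  by apply: IH => [|a]; [exact: cf|exact/CkW/Cg].
apply: (Ck_ext oU) C1 => x Ux; rewrite pd_comp//; first exact/df/UV.
by move=> j; have [dg _] := Cg j; exact: dg.
Qed.

Lemma partials_cons n e i (f : 'rV[R]_n -> R) :
  partials (i :: e) f = pd i (partials e f).
Proof. by []. Qed.

Lemma partials_rcons n e i (f : 'rV[R]_n -> R) :
  partials (rcons e i) f = partials e (pd i f).
Proof. by rewrite /partials foldr_rcons. Qed.

Lemma smooth_on_pd n (U : set 'rV[R]_n) f i :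
  smooth_on U f -> smooth_on U (pd i f).
Proof. by move=> sf e x Ux; have := sf (rcons e i) x Ux; rewrite partials_rcons. Qed.

Lemma smooth_on_differentiable n (U : set 'rV[R]_n) f x : open U ->
  smooth_on U f -> U x -> differentiable f x.
Proof.
move=> oU sf Ux; apply: differentiable_C1.
  by apply: filterS (open_near oU Ux) => y Uy i; have [_] := sf [::] y Uy.
by move=> i; have [] := sf [:: i] x Ux.
Qed.

(* A sealed copy of smooth_on, which is otherwise unfolded to a product by most
   tactics. *)
Variant smooth n (U : set 'rV[R]_n) f : Prop := Smooth of smooth_on U f.

Variant smoothmx n p q (U : set 'rV[R]_n) (F : 'rV[R]_n -> 'M[R]_(p, q)) : Prop :=
  Smoothmx of smooth_mx_on U F.

Lemma smooth_pd n (U : set 'rV[R]_n) f i : smooth U f -> smooth U (pd i f).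
Proof. by case=> sf; split; exact: smooth_on_pd. Qed.

Lemma smooth_differentiable n (U : set 'rV[R]_n) f x : open U ->
  smooth U f -> U x -> differentiable f x.
Proof. by move=> oU [sf]; exact: smooth_on_differentiable. Qed.

Lemma smooth_continuous n (U : set 'rV[R]_n) f x :
  smooth U f -> U x -> {for x, continuous f}.
Proof. by move=> [sf] Ux; have [] := sf [::] x Ux. Qed.

(** Coordinate derivability together with continuity of all partials yields full differentiability
    by [differentiable_C1], which is what each level of [Ck] demands. *)
Lemma smoothP n (U : set 'rV[R]_n) f : open U ->
  smooth U f <-> forall r, Ck r U f.
Proof.
move=> oU; split=> [[sf] r|].
  elim: r f sf => [|r IH] f sf; first by move=> x Ux; have [] := sf [::] x Ux.
  split=> [x Ux|i]; first exact: smooth_on_differentiable sf Ux.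
  exact/IH/smooth_on_pd.
move=> Cf; split=> e x Ux.
suff Ce r : Ck r U (partials e f).
  split=> [|i]; first exact: (Ce 0%N).
  by have [/(_ _ Ux) de _] := Ce 1%N; exact: diff_derivable.
elim: e r => [//|i e IH] r.
by have [_] := IH r.+1; exact.
Qed.

Section closure.
Variables (n : nat) (U : set 'rV[R]_n).
Hypothesis oU : open U.

Lemma smooth_ext f g : (forall x, U x -> f x = g x) ->
  smooth U f -> smooth U g.
Proof.
move=> fg /(smoothP _ oU) Cf; apply/(smoothP _ oU) => r.
exact: Ck_ext (Cf r).
Qed.

Lemma smooth_cst (c : R) : smooth U (fun=> c).
Proof. by apply/smoothP => // r; exact: Ck_cst. Qed.

Lemma smooth_coord j : smooth U (fun x => x 0 j).
Proof. by apply/smoothP => // r; exact: Ck_coord. Qed.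

Lemma smoothD f g : smooth U f -> smooth U g ->
  smooth U (fun x => f x + g x).
Proof.
move=> /(smoothP _ oU) Cf /(smoothP _ oU) Cg.
by apply/(smoothP _ oU) => r; exact: CkD.
Qed.

Lemma smoothM f g : smooth U f -> smooth U g ->
  smooth U (fun x => f x * g x).
Proof.
move=> /(smoothP _ oU) Cf /(smoothP _ oU) Cg.
by apply/(smoothP _ oU) => r; exact: CkM.
Qed.

Lemma smoothN f : smooth U f -> smooth U (fun x => - f x).
Proof.
move=> sf; apply: smooth_ext (smoothM (smooth_cst (-1)) sf) => x _.
by rewrite mulN1r.
Qed.

Lemma smoothB f g : smooth U f -> smooth U g ->
  smooth U (fun x => f x - g x).
Proof. by move=> sf sg; exact: (smoothD sf (smoothN sg)). Qed.

Lemma smooth_sum (I : Type) (s : seq I) F :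
  (forall a, smooth U (F a)) -> smooth U (fun x => \sum_(a <- s) F a x).
Proof.
move=> sF; elim: s => [|a s IH].
  by under eq_fun do rewrite big_nil; exact: smooth_cst.
by under eq_fun do rewrite big_cons; exact: (smoothD (sF a) IH).
Qed.

Lemma smooth_prod (I : Type) (s : seq I) F :
  (forall a, smooth U (F a)) -> smooth U (fun x => \prod_(a <- s) F a x).
Proof.
move=> sF; elim: s => [|a s IH].
  by under eq_fun do rewrite big_nil; exact: smooth_cst.
by under eq_fun do rewrite big_cons; exact: (smoothM (sF a) IH).
Qed.

Lemma smoothV f : (forall x, U x -> f x != 0) -> smooth U f ->
  smooth U (fun x => (f x)^-1).
Proof.
move=> f0 /(smoothP _ oU) Cf.
by apply/(smoothP _ oU) => r; exact: CkV.
Qed.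

Lemma smoothmxP (p q : nat) (F : 'rV[R]_n -> 'M[R]_(p, q)) :
  smoothmx U F <-> forall i j, smooth U (fun x => F x i j).
Proof. by split=> [[sF] i j|sF]; split=> // i j; have [] := sF i j. Qed.

Lemma smooth_entry (p q : nat) (F : 'rV[R]_n -> 'M[R]_(p, q)) i j :
  smoothmx U F -> smooth U (fun x => F x i j).
Proof. by move=> /smoothmxP. Qed.

Lemma smooth_det (p : nat) (M : 'rV[R]_n -> 'M[R]_p) :
  smoothmx U M -> smooth U (fun x => \det (M x)).
Proof.
move=> sM; apply: smooth_sum => s.
apply: smoothM; first exact: smooth_cst.
by apply: smooth_prod => a; exact: smooth_entry.
Qed.

End closure.

Lemma smooth_comp n p (U : set 'rV[R]_n) (V : set 'rV[R]_p) f
    (g : 'rV[R]_n -> 'rV[R]_p) : open U -> open V ->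
  (forall x, U x -> V (g x)) -> smooth V f -> smoothmx U g ->
  smooth U (fun x => f (g x)).
Proof.
move=> oU oV UV /(smoothP _ oV) Cf sg; apply/(smoothP _ oU) => r.
apply: Ck_comp (Cf r) _ => // j.
by move: r; apply/(smoothP _ oU); exact: smooth_entry.
Qed.

Lemma smoothS n (U V : set 'rV[R]_n) f :
  U `<=` V -> smooth V f -> smooth U f.
Proof. by move=> UV [sf]; split=> e x /UV; exact: sf. Qed.

Lemma smoothmxS n p q (U V : set 'rV[R]_n) (f : _ -> 'M[R]_(p, q)) :
  U `<=` V -> smoothmx V f -> smoothmx U f.
Proof. by move=> UV [sf]; split=> i j e x /UV; exact: sf. Qed.

Lemma smoothmx_continuous n p q (U : set 'rV[R]_n) (f : _ -> 'M[R]_(p, q)) x :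
  smoothmx U f -> U x -> {for x, continuous f}.
Proof.
move=> sf Ux; apply: continuous_mx => i j.
exact: (smooth_continuous (smooth_entry i j sf)).
Qed.

Lemma smoothmx_differentiable n p (U : set 'rV[R]_n) (f : _ -> 'rV[R]_p) x :
  open U -> smoothmx U f -> U x -> differentiable f x.
Proof.
move=> oU sf Ux; apply: differentiable_row => j.
exact: (smooth_differentiable oU (smooth_entry 0 j sf)).
Qed.

Lemma jacobianE n p (f : 'rV[R]_n -> 'rV[R]_p) x i j : differentiable f x ->
  'J f x i j = pd i (fun y => f y 0 j) x.
Proof.
move=> df; rewrite /jacobian mxE -deriveE// derive_mx ?mxE//.
exact: diff_derivable.
Qed.

End smooth_calculus.

Section difference_quotients.
Context {R : realType} {n : nat}.
Implicit Types (f : 'rV[R]_n -> R) (x a : 'rV[R]_n).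

Lemma translate_quotient f a x v :
  (fun h : R => h^-1 *: (((fun y => f (a + y)) \o shift x) (h *: v) - f (a + x)))
  = (fun h : R => h^-1 *: ((f \o shift (a + x)) (h *: v) - f (a + x))).
Proof. by apply/funext => h /=; rewrite addrCA. Qed.

Lemma derivable_translate f a x v :
  derivable f (a + x) v -> derivable (fun y => f (a + y)) x v.
Proof. by rewrite /derivable translate_quotient. Qed.

Lemma pd_translate i f a x : pd i (fun y => f (a + y)) x = pd i f (a + x).
Proof. by rewrite /pd /derive translate_quotient. Qed.

Lemma norm_delta_mx (t : R) (i : 'I_n) : `|t *: delta_mx 0 i : 'rV[R]_n| <= `|t|.
Proof.
apply: norm_le_entries => // j; rewrite !mxE eqxx/= normrM.
by case: (j == i); rewrite ?normr1 ?mulr1// normr0 mulr0.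
Qed.

(** The mean value theorem is used twice: along direction i for the difference of f and its
    translate by h e_j, then along direction j for [pd i f]. The second difference is symmetric in i
    and j, which is the key to [pdC]. *)
Lemma second_difference U f x i j (h : R) : open U -> smooth U f ->
  (forall s t : R, `|s| <= `|h| -> `|t| <= `|h| ->
     U (s *: delta_mx 0 j + (t *: delta_mx 0 i + x))) ->
  exists s t : R, [/\ `|s| <= `|h|, `|t| <= `|h| &
    f (h *: delta_mx 0 j + (h *: delta_mx 0 i + x)) - f (h *: delta_mx 0 i + x)
      - (f (h *: delta_mx 0 j + x) - f x) =
    h * h * pd j (pd i f) (s *: delta_mx 0 j + (t *: delta_mx 0 i + x))].
Proof.
move=> oU sf hU.
have hU0 (t : R) : `|t| <= `|h| -> U (t *: delta_mx 0 i + x).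
  by move=> th; have := hU 0 t; rewrite scale0r add0r normr0; apply.
pose g y := f (h *: delta_mx 0 j + y) - f y.
have dfU y : U y -> forall v, derivable f y v.
  by move=> Uy v; apply: diff_derivable; exact: (smooth_differentiable oU sf).
have [t th|t th E] := @MVT_line _ _ g x (delta_mx 0 i) h.
  apply: derivableB; last exact/dfU/hU0.
  by apply: derivable_translate; apply/dfU/hU.
have {}E : g (h *: delta_mx 0 i + x) - g x =
    h * (pd i f (h *: delta_mx 0 j + (t *: delta_mx 0 i + x)) -
         pd i f (t *: delta_mx 0 i + x)).
  rewrite E; congr (_ * _).
  rewrite deriveB; first by rewrite -!/(pd _ _ _) pd_translate.
    by apply: derivable_translate; apply/dfU/hU.
  exact/dfU/hU0.
have [s sh|s sh E'] := @MVT_line _ _ (pd i f) (t *: delta_mx 0 i + x) (delta_mx 0 j) h.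
  by apply: diff_derivable; exact: (smooth_differentiable oU (smooth_pd i sf) (hU s t sh th)).
exists s, t; split=> //.
by rewrite -mulrA -E' -E.
Qed.

End difference_quotients.

(* Otherwise unification unfolds pd down to a limit. *)
Opaque pd.

Section mixed_partials.
Context {R : realType} {n : nat}.
Implicit Types (f : 'rV[R]_n -> R) (x : 'rV[R]_n).

Lemma ler_dist_half (a b c e : R) :
  `|a - c| <= e / 2 -> `|b - c| <= e / 2 -> `|a - b| <= e.
Proof. by rewrite !ler_norml => /andP[? ?] /andP[? ?]; apply/andP; split; lra. Qed.

(** The same second difference, divided by [h * h], is a value of each mixed derivative at some
    point close to x; continuity of both at x makes them agree up to any e. *)
Lemma pdC U f x i j : open U -> smooth U f -> U x ->
  pd i (pd j f) x = pd j (pd i f) x.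
Proof.
move=> oU sf Ux; apply/eqP; rewrite -subr_eq0 -normr_le0; apply/ler_addgt0Pr => e e0.
rewrite add0r.
have e20 : 0 < e / 2 by rewrite divr_gt0.
have cij (a b : 'I_n) :
    \forall y \near x, `|pd a (pd b f) x - pd a (pd b f) y| <= e / 2.
  by have /cvgrPdist_le /(_ _ e20) := smooth_continuous (smooth_pd a (smooth_pd b sf)) Ux.
have H : \forall y \near x, U y /\ `|pd i (pd j f) x - pd i (pd j f) y| <= e / 2 /\
    `|pd j (pd i f) x - pd j (pd i f) y| <= e / 2.
  exact: filterI (open_near oU Ux) (filterI (cij i j) (cij j i)).
have [r /= r0 rP] := (nbhs_ballP x _).1 H.
(* The points s e_j + t e_i + x with |s|, |t| <= h lie within 2 h of x, hence inside the ball of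
   radius r. *)
pose h := r / 3.
have h0 : 0 < h by rewrite divr_gt0.
have hx (a b : 'I_n) (s t : R) : `|s| <= `|h| -> `|t| <= `|h| ->
    ball x r (s *: delta_mx 0 a + (t *: delta_mx 0 b + x)).
  move=> sh th; rewrite -ball_normE /ball_/= distrC addrA addrK.
  rewrite (gtr0_norm h0) in sh th.
  apply: (le_lt_trans (ler_normD _ _)).
  apply: (@le_lt_trans _ _ (h + h)); last by rewrite /h; lra.
  by apply: lerD; apply: (le_trans (norm_delta_mx _ _)).
have [|s [t [sh th E]]] := @second_difference R n U f x i j h oU sf.
  by move=> s t sh th; have [] := rP _ (hx j i s t sh th).
have [|s' [t' [sh' th' E']]] := @second_difference R n U f x j i h oU sf.
  by move=> s' t' sh' th'; have [] := rP _ (hx i j s' t' sh' th').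
have EE : pd j (pd i f) (s *: delta_mx 0 j + (t *: delta_mx 0 i + x)) =
          pd i (pd j f) (s' *: delta_mx 0 i + (t' *: delta_mx 0 j + x)).
  apply: (@mulfI _ (h * h)); first by rewrite mulf_neq0// gt_eqF.
  apply: (etrans (esym E)); apply: (etrans _ E').
  rewrite (addrCA (h *: delta_mx 0 i : 'rV[R]_n)) !opprB.
  by rewrite [LHS]addrACA [RHS]addrACA; congr (_ + _); exact: addrC.
have [_ [_ H1]] := rP _ (hx j i s t sh th).
have [_ [H2 _]] := rP _ (hx i j s' t' sh' th').
move: H1 H2; rewrite EE => H1 H2.
exact: (ler_dist_half H2 H1).
Qed.

End mixed_partials.

Section derivative_of_determinant.
Context {R : realType} {n : nat}.

Lemma differentiable_prod p (F : 'I_p -> 'rV[R]_n -> R) x :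
  (forall a, differentiable (F a) x) ->
  differentiable (fun y => \prod_a F a y) x.
Proof.
elim: p F => [|p IH] F dF.
  under eq_fun do rewrite big_ord0; exact: differentiable_cst.
under eq_fun do rewrite big_ord_recl.
apply: differentiableM; first exact: dF.
exact: IH.
Qed.

Lemma pd_prod p i (F : 'I_p -> 'rV[R]_n -> R) x :
  (forall a, differentiable (F a) x) ->
  pd i (fun y => \prod_a F a y) x =
  \sum_a \prod_b (if b == a then pd i (F b) x else F b x).
Proof.
elim: p F => [|p IH] F dF.
  by under eq_fun do rewrite big_ord0; rewrite pd_cst big_ord0.
under eq_fun do rewrite big_ord_recl.
rewrite pdM//; last exact: differentiable_prod.
rewrite IH// big_ord_recl; congr (_ + _).
  by rewrite big_ord_recl eqxx; congr (_ * _); apply: eq_bigr => b _.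
rewrite mulr_sumr; apply: eq_bigr => a _.
by rewrite big_ord_recl (_ : (ord0 == lift ord0 a) = false).
Qed.

Lemma pd_det p i (M : 'rV[R]_n -> 'M[R]_p) x :
  (forall a b, differentiable (fun y => M y a b) x) ->
  pd i (fun y => \det (M y)) x =
  \sum_a \sum_b pd i (fun y => M y a b) x * cofactor (M x) a b.
Proof.
move=> dM; rewrite /determinant pd_sum; last first.
  move=> s; apply: differentiableM; first exact: differentiable_cst.
  exact: differentiable_prod.
(* [M' a] is M with only row a differentiated; expanding its determinant along that row produces
   cofactors of M. *)
pose M' a := \matrix_(c, b) (if c == a then pd i (fun y => M y c b) x else M x c b).
transitivity (\sum_a \det (M' a)).
  rewrite exchange_big/=; apply: eq_bigr => s _.
  rewrite pdM; [|exact: differentiable_cst|exact: differentiable_prod].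
  rewrite pd_cst mul0r add0r pd_prod// mulr_sumr; apply: eq_bigr => a _.
  by congr (_ * _); apply: eq_bigr => b _; rewrite mxE.
apply: eq_bigr => a _; rewrite (expand_det_row _ a); apply: eq_bigr => b _.
rewrite mxE eqxx; congr (_ * _); rewrite /cofactor; congr (_ * \det _).
by apply/matrixP => c d; rewrite !mxE eq_sym (negbTE (neq_lift _ _)).
Qed.

(** Jacobi's formula: the relation M N = 1 rewrites the adjugate of M as det M times N. *)
Lemma pd_det_inverse p i (M : 'rV[R]_n -> 'M[R]_p) (N : 'M[R]_p) x :
  (forall a b, differentiable (fun y => M y a b) x) -> M x *m N = 1%:M ->
  pd i (fun y => \det (M y)) x =
  \det (M x) * \sum_a \sum_b N b a * pd i (fun y => M y a b) x.
Proof.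
move=> dM MN; rewrite pd_det// mulr_sumr; apply: eq_bigr => a _.
rewrite mulr_sumr; apply: eq_bigr => b _.
have -> : cofactor (M x) a b = \det (M x) * N b a.
  transitivity ((\adj (M x)) b a); first by rewrite mxE.
  by rewrite -[\adj _]mulmx1 -MN mulmxA mul_adj_mx mul_scalar_mx mxE.
by ring.
Qed.

End derivative_of_determinant.

Ltac smoothness :=
  repeat match goal with
  | |- smooth _ (fun x => @GRing.add _ (@?f x) (@?g x)) =>
      apply: (@smoothD _ _ _ _ f g)
  | |- smooth _ (fun x => @GRing.mul _ (@?f x) (@?g x)) =>
      apply: (@smoothM _ _ _ _ f g)
  | |- smooth _ (fun x => @GRing.opp _ (@?f x)) =>
      apply: (@smoothN _ _ _ _ f)
  | |- smooth _ (fun x => \sum_(a <- _) (@?F a x)) =>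
      apply: (@smooth_sum _ _ _ _ _ _ F)
  | |- smooth _ (fun x => pd _ (@?f x) x) => apply: smooth_pd
  | |- smooth _ (pd _ _) => apply: smooth_pd
  | |- smooth _ (fun x => fun_of_matrix x _ _) => apply: smooth_coord
  | |- smooth _ (fun x => pd _ _ x) => apply: smooth_pd
  | |- smooth _ (fun x => ?c) => apply: smooth_cst
  | |- forall _, _ => intro
  | H : smooth ?U ?f |- smooth ?U ?f => exact H
  | |- smooth _ _ => eassumption
  | H : smoothmx ?U ?f |- smooth ?U (fun x => fun_of_matrix (?f x) ?i ?j) =>
      exact (smooth_entry i j H)
  | H : open ?U |- open ?U => exact H
  end.

Section smooth_pd_rules.
Context {R : realType} {n : nat} (A : set 'rV[R]_n).
Hypothesis oA : open A.
Implicit Types (f g : 'rV[R]_n -> R) (x : 'rV[R]_n).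

Lemma spdD i f g x : smooth A f -> smooth A g -> A x ->
  pd i (fun y => f y + g y) x = pd i f x + pd i g x.
Proof. by move=> sf sg Ax; apply: pdD; exact: (smooth_differentiable oA). Qed.

Lemma spdN i f x : smooth A f -> A x ->
  pd i (fun y => - f y) x = - pd i f x.
Proof. by move=> sf Ax; apply: pdN; exact: (smooth_differentiable oA). Qed.

Lemma spdM i f g x : smooth A f -> smooth A g -> A x ->
  pd i (fun y => f y * g y) x = pd i f x * g x + f x * pd i g x.
Proof. by move=> sf sg Ax; apply: pdM; exact: (smooth_differentiable oA). Qed.

Lemma spd_sum i (I : Type) (r : seq I) (F : I -> 'rV[R]_n -> R) x :
  (forall a, smooth A (F a)) -> A x ->
  pd i (fun y => \sum_(a <- r) F a y) x = \sum_(a <- r) pd i (F a) x.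
Proof. by move=> sF Ax; apply: pd_sum => a; exact: (smooth_differentiable oA). Qed.

(** Exchanges the two outermost derivatives in the induction of
    [weighted_partials_reduced_divergence]. [W] and [W'] will differ in the order of two weights,
    and [ia], [ic] allow normal or tangential directions. *)
Lemma pd_sum_swap p q (ia : 'I_p -> 'I_n) (ic : 'I_q -> 'I_n)
    (W : 'I_q -> 'I_p -> 'rV[R]_n -> R) (W' : 'I_p -> 'I_q -> 'rV[R]_n -> R) x :
  (forall a c, smooth A (W c a)) -> (forall a c y, A y -> W c a y = W' a c y) ->
  A x ->
  \sum_c pd (ic c) (fun y => \sum_a pd (ia a) (W c a) y) x =
  \sum_a pd (ia a) (fun y => \sum_c pd (ic c) (W' a c) y) x.
Proof.
move=> sW WW' Ax.
have sW' a c : smooth A (W' a c) by apply: smooth_ext (sW a c) => // y; exact: WW'.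
under eq_bigr => c _.
  rewrite spd_sum//; last by move=> a; exact: smooth_pd.
  over.
under [RHS]eq_bigr => a _.
  rewrite spd_sum//; last by move=> c; exact: smooth_pd.
  over.
rewrite exchange_big/=; apply: eq_bigr => a _; apply: eq_bigr => c _.
rewrite (pdC _ _ oA (sW a c) Ax); apply: (pd_ext _ oA) Ax => y Ay.
by apply: (pd_ext _ oA) Ay; exact: WW'.
Qed.

End smooth_pd_rules.

(** * Iterated transformed derivatives *)

Section transformed_derivatives.
Context {R : realType} {k m : nat} (A : set 'rV[R]_(k + m)).
Variables (b C : 'rV[R]_(k + m) -> 'M[R]_k) (X : 'rV[R]_(k + m) -> 'rV[R]_(k + m)).
Hypotheses (oA : open A) (sb : smoothmx A b) (sC : smoothmx A C)
  (sX : smoothmx A X).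
Implicit Types (f g H : 'rV[R]_(k + m) -> R) (x : 'rV[R]_(k + m)).

(* This is sum_J d_J (b_IJ H), the sum over all multi-indices J
   of length |I|. *)
Fixpoint weighted_partials (I : seq 'I_k) H : 'rV[R]_(k + m) -> R :=
  match I with
  | [::] => H
  | i :: I' => fun x => \sum_(j < k)
      pd (lshift m j) (weighted_partials I' (fun y => b y i j * H y)) x
  end.
Local Notation WP := weighted_partials.

Definition divergence H x := \sum_c pd c (fun y => X y 0 c * H y) x.

Definition along g x := \sum_c X x 0 c * pd c g x.

Lemma smooth_weighted_partials I H : smooth A H -> smooth A (WP I H).
Proof.
elim: I H => [//|i I IH] H sH /=.
apply: smooth_sum => // j; apply: smooth_pd; apply: IH.
by smoothness.
Qed.

Lemma weighted_partials_ext I f g : (forall x, A x -> f x = g x) ->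
  forall x, A x -> WP I f x = WP I g x.
Proof.
elim: I f g => [//|i I IH] f g fg x Ax /=.
apply: eq_bigr => j _; apply: (pd_ext _ oA) Ax => y Ay.
by apply: IH Ay => z Az; rewrite fg.
Qed.

Lemma weighted_partialsD I f g x : smooth A f -> smooth A g -> A x ->
  WP I (fun y => f y + g y) x = WP I f x + WP I g x.
Proof.
move=> sf sg; elim: I f g sf sg x => [//|i I IH] f g sf sg x Ax /=.
rewrite -big_split/=; apply: eq_bigr => j _.
rewrite -(spdD oA)//; [|by apply: smooth_weighted_partials; smoothness..].
apply: (pd_ext _ oA) Ax => y Ay.
rewrite -IH//; [|by smoothness..].
by apply: weighted_partials_ext Ay => z Az; rewrite mulrDr.
Qed.

Lemma weighted_partialsN I f x : smooth A f -> A x ->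
  WP I (fun y => - f y) x = - WP I f x.
Proof.
move=> sf; elim: I f sf x => [//|i I IH] f sf x Ax /=.
rewrite -sumrN; apply: eq_bigr => j _.
rewrite -(spdN oA)//; last by apply: smooth_weighted_partials; smoothness.
apply: (pd_ext _ oA) Ax => y Ay.
rewrite -IH//; last by smoothness.
by apply: weighted_partials_ext Ay => z Az; rewrite mulrN.
Qed.

Lemma weighted_partials_sum I (r : seq 'I_k) (F : 'I_k -> 'rV[R]_(k + m) -> R) x :
  (forall a, smooth A (F a)) -> A x ->
  WP I (fun y => \sum_(a <- r) F a y) x = \sum_(a <- r) WP I (F a) x.
Proof.
move=> sF Ax; elim: r => [|a r IH].
  (* The empty sum is written 0 + - 0, so that the rules for sums and opposites give a difference of
     two equal terms. *)
  rewrite big_nil (@weighted_partials_ext _ _ (fun y => 0 + - 0)) => [|y _|//]; last first.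
    by rewrite big_nil subr0.
  rewrite weighted_partialsD//; [|by smoothness..].
  by rewrite weighted_partialsN ?subrr//; smoothness.
rewrite big_cons -IH -weighted_partialsD//; last by smoothness.
by apply: weighted_partials_ext Ax => y Ay; rewrite big_cons.
Qed.

Lemma smooth_divergence H : smooth A H -> smooth A (divergence H).
Proof. by move=> sH; rewrite /divergence; smoothness. Qed.

Lemma smooth_along g : smooth A g -> smooth A (along g).
Proof. by move=> sg; rewrite /along; smoothness. Qed.

Lemma divergenceM g H x : smooth A g -> smooth A H -> A x ->
  divergence (fun y => g y * H y) x = g x * divergence H x + along g x * H x.
Proof.
move=> sg sH Ax; rewrite /divergence /along mulr_sumr mulr_suml -big_split/=.
apply: eq_bigr => c _.
rewrite (@pd_ext _ _ _ _ _ (fun y => g y * (X y 0 c * H y)) oA _ x Ax).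
  rewrite (spdM oA)//; last by smoothness.
  by rewrite mulrCA addrC mulrA.
by move=> y _; rewrite mulrCA.
Qed.

Variable l : 'I_k.
Hypothesis X_normal : forall x, A x -> forall a,
  X x 0 (lshift m a) = b x l a + \sum_j x 0 (lshift m j) * C x j a.
Hypothesis bC : forall x, A x -> forall i a,
  \sum_j b x i j * C x j a = along (fun y => b y i a) x.

Definition reduced_divergence H x := divergence H x - \tr (C x) * H x.

Lemma smooth_trC : smooth A (fun x => \tr (C x)).
Proof. by rewrite /mxtrace; smoothness. Qed.

Lemma smooth_reduced H : smooth A H -> smooth A (reduced_divergence H).
Proof.
move=> sH; apply: smoothD => //; first exact: smooth_divergence.
by apply: smoothN => //; apply: smoothM => //; exact: smooth_trC.
Qed.

(** In the normal part of the divergence, d_a applied to u_j C_ja H releases C_ja H exactly when a =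
    j. These terms add up to tr C times H, which is what [reduced_divergence] subtracts. *)
Lemma reduced_divergence_split H x : smooth A H -> A x ->
  reduced_divergence H x =
  \sum_(a < k) pd (lshift m a) (fun y => b y l a * H y) x
  + \sum_(j < k) x 0 (lshift m j) *
      \sum_(a < k) pd (lshift m a) (fun y => C y j a * H y) x
  + \sum_(a < m) pd (rshift k a) (fun y => X y 0 (rshift k a) * H y) x.
Proof.
move=> sH Ax; rewrite /reduced_divergence /divergence big_split_ord/= addrAC.
congr (_ + _); apply/eqP; rewrite subr_eq; apply/eqP.
transitivity (\sum_(a < k) (pd (lshift m a) (fun y => b y l a * H y) x +
    \sum_(j < k) (x 0 (lshift m j) * pd (lshift m a) (fun y => C y j a * H y) x +
    (a == j)%:R * (C x j a * H x)))).
  apply: eq_bigr => a _.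
  rewrite (@pd_ext _ _ _ _ _ (fun y => b y l a * H y +
      \sum_(j < k) y 0 (lshift m j) * (C y j a * H y)) oA _ x Ax); last first.
    move=> y Ay; rewrite X_normal// mulrDl; congr (_ + _).
    by rewrite mulr_suml; apply: eq_bigr => j _; rewrite mulrA.
  rewrite (spdD oA)//; [|by smoothness..]; congr (_ + _).
  rewrite (spd_sum oA)//; last by smoothness.
  apply: eq_bigr => j _; rewrite (spdM oA)//; [|by smoothness..].
  by rewrite pd_coord (inj_eq (@lshift_inj _ _)) addrC.
rewrite big_split/= -addrA; congr (_ + _).
rewrite exchange_big/= /mxtrace mulr_suml -big_split/=; apply: eq_bigr => j _.
rewrite big_split/= mulr_sumr; congr (_ + _).
rewrite (bigD1 j)//= eqxx mul1r big1 ?addr0// => a aj.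
by rewrite (negbTE aj) mul0r.
Qed.

(* On the surface, where the first k coordinates vanish, the middle sum
   disappears, and the last one integrates to 0. *)
Lemma weighted_partials_reduced_divergence I H x : smooth A H -> A x ->
  WP I (reduced_divergence H) x = WP (l :: I) H x
  + \sum_(j < k) x 0 (lshift m j) *
      \sum_(a < k) pd (lshift m a) (WP I (fun y => C y j a * H y)) x
  + \sum_(a < m) pd (rshift k a) (WP I (fun y => X y 0 (rshift k a) * H y)) x.
Proof.
elim: I H x => [|i I IH] H x sH Ax; first exact: reduced_divergence_split.
(* For the weight b_ic, [L] is the main term, [G] the coefficient of u_j, [K] the tangential
   divergence, and [E] the correction for moving b_ic inside the divergence. *)
pose G c j y := \sum_(a < k) pd (lshift m a) (WP I (fun y => C y j a * (b y i c * H y))) y.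
have sG c j : smooth A (G c j).
  rewrite /G; smoothness; apply: smooth_weighted_partials; by smoothness.
pose K c y := \sum_(a < m) pd (rshift k a) (WP I (fun y => X y 0 (rshift k a) * (b y i c * H y))) y.
have sK c : smooth A (K c).
  rewrite /K; smoothness; apply: smooth_weighted_partials; by smoothness.
pose L c := WP (l :: I) (fun y => b y i c * H y).
have sL c : smooth A (L c) by apply: smooth_weighted_partials; smoothness.
pose E c := WP I (fun y => along (fun z => b z i c) y * H y).
have sbH c : smooth A (fun y => along (fun z => b z i c) y * H y).
  by apply: smoothM => //; apply: smooth_along; smoothness.
have sE c : smooth A (E c) by apply: smooth_weighted_partials.
(* By Leibniz, b_ic times the reduced divergence of H is the reduced divergence of b_ic H minus
   X(b_ic) H; the induction hypothesis applies to b_ic H. *)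
have step c y : A y -> WP I (fun z => b z i c * reduced_divergence H z) y =
    L c y + \sum_(j < k) y 0 (lshift m j) * G c j y + K c y - E c y.
  move=> Ay; rewrite -IH; [|by smoothness|by []].
  rewrite -weighted_partialsN// -weighted_partialsD//; last by apply: smoothN.
    apply: weighted_partials_ext Ay => z Az; rewrite /reduced_divergence divergenceM//.
    by ring.
    by smoothness.
  by apply: smooth_reduced; smoothness.
rewrite [LHS]/=.
transitivity (\sum_(c < k) (pd (lshift m c) (L c) x +
    (\sum_(j < k) x 0 (lshift m j) * pd (lshift m c) (G c j) x + G c c x) +
    pd (lshift m c) (K c) x - pd (lshift m c) (E c) x)).
  apply: eq_bigr => c _; rewrite (pd_ext _ oA (step c))//.
  rewrite (spdD oA)//; [|by smoothness..]; congr (_ + _); last first.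
    by rewrite (spdN oA).
  rewrite (spdD oA)//; [|by smoothness..]; congr (_ + _).
  rewrite (spdD oA)//; [|by smoothness..]; congr (_ + _).
  rewrite (spd_sum oA)//; last by smoothness.
  under eq_bigr => j _.
    rewrite (spdM oA)//; last by smoothness.
    rewrite pd_coord (inj_eq (@lshift_inj _ _)); over.
  rewrite big_split/= addrC; congr (_ + _).
  rewrite (bigD1 c)//= eqxx mul1r big1 ?addr0// => j jc.
  by rewrite eq_sym (negbTE jc) mul0r.
(* The terms [G c c] are released when d_c hits the factor u_c. Summed over c, their weights b_ic
   C_ca form X(b_ia) by [bC], so they equal the derivatives of the corrections [E]. *)
have cancel : \sum_(c < k) G c c x = \sum_(c < k) pd (lshift m c) (E c) x.
  rewrite /G exchange_big/=; apply: eq_bigr => a _.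
  rewrite -(spd_sum oA)//; last first.
    by move=> c; apply: smooth_weighted_partials; smoothness.
  apply: (pd_ext _ oA) Ax => y Ay; rewrite -weighted_partials_sum//; last by smoothness.
  apply: weighted_partials_ext Ay => z Az; rewrite -bC// mulr_suml; apply: eq_bigr => c _.
  by rewrite mulrA [C _ _ _ * _]mulrC.
rewrite !big_split/= sumrN cancel.
have regroup (p q r s p' q' r' : R) :
  p = p' -> q = q' -> r = r' -> p + (q + s) + r - s = p' + q' + r'.
  by move=> -> -> ->; ring.
(* In each of the three remaining pairs, the derivative coming from l or X and the one coming from i
   occur in opposite order. *)
apply: regroup.
- apply: (@pd_sum_swap _ _ A oA _ _ _ _ (fun c j => WP I (fun y => b y l j * (b y i c * H y)))
    (fun j c => WP I (fun y => b y i c * (b y l j * H y)))) => // [a c|a c y Ay].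
    by apply: smooth_weighted_partials; smoothness.
  by apply: weighted_partials_ext Ay => z Az; rewrite mulrCA.
- rewrite exchange_big/=; apply: eq_bigr => j _; rewrite -mulr_sumr.
  apply: (congr1 (fun z => x 0 (lshift m j) * z)).
  apply: (@pd_sum_swap _ _ A oA _ _ _ _ (fun c a => WP I (fun y => C y j a * (b y i c * H y)))
    (fun a c => WP I (fun y => b y i c * (C y j a * H y)))) => // [a c|a c y Ay].
    by apply: smooth_weighted_partials; smoothness.
  by apply: weighted_partials_ext Ay => z Az; rewrite mulrCA.
- apply: (@pd_sum_swap _ _ A oA _ _ _ _
    (fun c a => WP I (fun y => X y 0 (rshift k a) * (b y i c * H y)))
    (fun a c => WP I (fun y => b y i c * (X y 0 (rshift k a) * H y)))) => // [a c|a c y Ay].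
    by apply: smooth_weighted_partials; smoothness.
  by apply: weighted_partials_ext Ay => z Az; rewrite mulrCA.
Qed.

End transformed_derivatives.

(** * Iterated integrals of compactly supported functions *)

Section compact_support.
Context {R : realType}.

Definition supported_in_ball n (f : 'rV[R]_n -> R) (M : R) :=
  forall x, M < `|x| -> f x = 0.

Lemma closed_ball0_compact n (M : R) : compact [set x : 'rV[R]_n | `|x| <= M].
Proof.
apply: bounded_closed_compact.
  by exists M; split => [|N MN x /= xM]; [exact: num_real|exact/ltW/(le_lt_trans xM)].
apply: (@closed_comp _ _ (fun x : 'rV[R]_n => `|x|) [set r : R | r <= M]).
  by move=> x _; exact: norm_continuous.
exact: closed_le.
Qed.

(** By compactness one d serves all x of the closed ball; if both points lie outside it, both values
    are 0. *)
Lemma uniform_modulus n (f : 'rV[R]_n -> R) (M e : R) :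
  continuous f -> supported_in_ball f M -> 0 < e ->
  exists2 d, 0 < d & forall x y, `|x - y| < d -> `|f x - f y| <= e.
Proof.
move=> cf fM e0.
have e20 : 0 < e / 2 by rewrite divr_gt0.
have /compact_near_coveringP cK := @closed_ball0_compact n M.
pose P (d : R) (x : 'rV[R]_n) := forall y, `|x - y| < d -> `|f x - f y| <= e.
have : \forall d \near (0 : R)^'+, [set x : 'rV[R]_n | `|x| <= M] `<=` P d.
  apply: cK => x _ /=.
  have /cvgrPdist_le /(_ _ e20) := cf x.
  move=> /nbhs_ballP[r /= r0 rP].
  have r20 : 0 < r / 2 by rewrite divr_gt0.
  exists (ball x (r / 2), [set d : R | d < r / 2]) => /=.
    by split; [exact: nbhsx_ballx|exact: nbhs_right_lt].
  move=> [x' d] /= [xx' dr] y yd.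
  have {}xx' : `|x - x'| < r / 2 by move: xx'; rewrite -ball_normE.
  have xy : `|x - y| < r.
    rewrite -(subrKA x'); apply: (le_lt_trans (ler_normD _ _)).
    by rewrite (splitr r) ltrD// (lt_trans yd).
  apply: (@ler_dist_half _ _ _ (f x)); rewrite distrC; apply: rP; rewrite -ball_normE//=.
  by rewrite (lt_trans xx')// ltr_pdivrMr// ltr_pMr// ltr1n.
move=> /(filterI (nbhs_right_gt 0))/filter_ex[d [/= d0 dP]].
exists d => // x y xy.
have [xM|xM] := leP `|x| M; first exact: dP.
have [yM|yM] := leP `|y| M; first by rewrite distrC; apply: dP => //; rewrite distrC.
by rewrite !fM// subrr normr0 ltW.
Qed.

End compact_support.

Section line_integral.
Context {R : realType}.
Local Notation mu := (@lebesgue_measure R).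
Implicit Types (g h : R -> R) (M : R).

Definition vanishes_beyond M g := forall t, M < `|t| -> g t = 0.

Lemma vanishes_beyond_restrict M g : vanishes_beyond M g ->
  g = g \_ `[- M, M].
Proof.
move=> gM; apply/funext => t; rewrite patchE; case: ifPn => // tM.
apply: gM; rewrite ltNge; apply: contra tM => tM.
by rewrite inE/= in_itv/= -ler_norml.
Qed.

Lemma integrable_vanishing M g : continuous g -> vanishes_beyond M g ->
  mu.-integrable setT (EFin \o g).
Proof.
move=> cg gM; rewrite (vanishes_beyond_restrict gM).
rewrite (_ : EFin \o _ = (EFin \o g) \_ `[- M, M]); last first.
  by rewrite restrict_EFin.
apply/(integrable_mkcond _ _).1 => //.
apply: continuous_compact_integrable; first exact: segment_compact.
exact: continuous_subspaceT.
Qed.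

Lemma Rintegral_vanishing M g : vanishes_beyond M g ->
  \int[mu]_t g t = \int[mu]_(t in `[- M, M]) g t.
Proof.
by move=> gM; rewrite {1}(vanishes_beyond_restrict gM) -Rintegral_mkcond.
Qed.

Lemma Rintegral_bound M B g : 0 <= M -> continuous g -> vanishes_beyond M g ->
  (forall t, `|g t| <= B) -> `|\int[mu]_t g t| <= 2 * M * B.
Proof.
move=> M0 cg gM gB.
have cgI : mu.-integrable `[- M, M] (EFin \o g).
  apply: continuous_compact_integrable; first exact: segment_compact.
  exact: continuous_subspaceT.
rewrite (Rintegral_vanishing gM); apply: (le_trans (le_normr_Rintegral _ cgI)) => //.
have -> : 2 * M * B = \int[mu]_(t in `[- M, M]) B.
  rewrite Rintegral_cst//.
  apply: etrans (congr1 (fun z => B * fine z) (esym (lebesgue_measure_itv `[- M, M]))).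
  rewrite /= lte_fin.
  case: ifPn => [_|]; first by rewrite -EFinD/= opprK; ring.
  rewrite -leNgt => MM; have -> : M = 0 by apply/eqP; rewrite eq_le M0 andbT; lra.
  by rewrite /= mulr0 mul0r mulr0.
apply: le_Rintegral => //.
- apply: continuous_compact_integrable; first exact: segment_compact.
  by apply: continuous_subspaceT => t; apply: continuous_comp; [exact: cg|exact: norm_continuous].
- apply: continuous_compact_integrable; first exact: segment_compact.
  by apply: continuous_subspaceT => t; exact: cst_continuous.
Qed.

Lemma Rintegral_derivative M g h : 0 < M -> continuous h ->
  (forall t : R, is_derive t 1 g (h t)) -> vanishes_beyond M g -> \int[mu]_t h t = 0.
Proof.
move=> M0 ch gh gM.
have cg : continuous g.
  move=> t; apply: differentiable_continuous; apply/derivable1_diffP.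
  by have [] := gh t.
have hM : vanishes_beyond M h.
  move=> t Mt; have [dg <-] := gh t.
  rewrite (@near_eq_derive _ _ _ g (cst 0)) ?derive_cst//.
  have : \forall s \near t, M < `|s|.
    by have /cvgr_gt /(_ _ Mt) := @norm_continuous _ R^o t.
  by apply: filterS => s; exact: gM.
(* Integrating up to M + 1 puts both endpoints strictly beyond M, where g is known to be 0. *)
have MM : - (M + 1) < M + 1 by lra.
have hM1 : vanishes_beyond (M + 1) h by move=> t Mt; apply: hM; lra.
rewrite (Rintegral_vanishing hM1) /Rintegral (@continuous_FTC2 _ h g)//.
- have M10 : M < `|M + 1| by rewrite gtr0_norm; lra.
  by rewrite (gM _ M10) gM ?normrN//= subrr.
- exact: continuous_subspaceT.
- split=> [t _||].
  + by have [] := gh t.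
  + by apply: cvg_at_right_filter; exact: cg.
  + by apply: cvg_at_left_filter; exact: cg.
- by move=> t _; rewrite derive1E; have [_ ->] := gh t.
Qed.

End line_integral.

Section iterated_integral.
Context {R : realType}.

Definition slice n (f : 'rV[R]_(1 + n) -> R) (t : R) : 'rV[R]_n -> R :=
  fun y => f (row_mx (t%:M : 'rV[R]_1) y).

Lemma norm_row_mx_r n (t : R) (y : 'rV[R]_n) :
  `|y| <= `|row_mx (t%:M : 'rV[R]_1) y|.
Proof.
apply: norm_le_entries => // j.
rewrite -(row_mxEr (t%:M : 'rV[R]_1)); exact: entry_le_norm.
Qed.

Lemma norm_row_mx_l n (t : R) (y : 'rV[R]_n) :
  `|t| <= `|row_mx (t%:M : 'rV[R]_1) y|.
Proof.
have := entry_le_norm (row_mx (t%:M : 'rV[R]_1) y) (lshift n 0).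
by rewrite row_mxEl mxE eqxx mulr1n.
Qed.

Lemma row_mx_shift_l n (h t : R) (y : 'rV[R]_n) :
  h *: delta_mx 0 (lshift n 0) + row_mx (t%:M : 'rV[R]_1) y =
  row_mx ((h + t)%:M : 'rV[R]_1) y.
Proof.
apply/rowP => j; rewrite !mxE; case: splitP => [j' jj'|j' jj'].
  have -> : j = lshift n 0 by apply: val_inj; rewrite /= jj' ord1.
  by rewrite !mxE !ord1 !eqxx/= mulr1 !mulr1n.
rewrite (_ : (j == lshift n 0) = false) ?andbF ?mulr0 ?add0r//.
by apply/eqP => jl; move: jj'; rewrite jl.
Qed.

Lemma row_mx_shift_r n (h t : R) (y : 'rV[R]_n) (b : 'I_n) :
  h *: delta_mx 0 (rshift 1 b) + row_mx (t%:M : 'rV[R]_1) y =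
  row_mx (t%:M : 'rV[R]_1) (h *: delta_mx 0 b + y).
Proof.
apply/rowP => j; rewrite !mxE; case: splitP => [j' jj'|j' jj'].
  rewrite (_ : (j == rshift 1 b) = false) ?andbF ?mulr0 ?add0r//.
  by apply/eqP => jl; have := ltn_ord j'; rewrite -jj' jl.
have -> : j = rshift 1 j' by apply: val_inj.
by rewrite !mxE (inj_eq (@rshift_inj _ _)).
Qed.

Lemma slice_continuous n (f : 'rV[R]_(1 + n) -> R) t :
  continuous f -> continuous (slice f t).
Proof.
move=> cf y; apply: (@continuous_comp _ _ _ (fun y => row_mx (t%:M : 'rV[R]_1) y) f).
  apply: continuous_mx => i j.
  rewrite (_ : (fun z : 'rV[R]_n => (row_mx (t%:M : 'rV[R]_1) z : 'rV[R]_(1 + n)) i j) = fun z =>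
    match fintype.split j with inl a => (t%:M : 'rV[R]_1) i a | inr a => z i a end); last first.
    by apply/funext => z; rewrite mxE.
  case: (fintype.split j) => a; first exact: cst_continuous.
  exact: coord_continuous.
exact: cf.
Qed.

Lemma slice_supported n (f : 'rV[R]_(1 + n) -> R) M t :
  supported_in_ball f M -> supported_in_ball (slice f t) M.
Proof. by move=> fM y yM; apply: fM; exact: (lt_le_trans yM (norm_row_mx_r _ _)). Qed.

Lemma slice_eq0 n (f : 'rV[R]_(1 + n) -> R) M t : M < `|t| ->
  supported_in_ball f M -> slice f t = fun=> 0.
Proof.
move=> Mt fM; apply/funext => y; apply: fM.
exact: (lt_le_trans Mt (norm_row_mx_l _ _)).
Qed.

Definition continuous_in_ball n (f : 'rV[R]_n -> R) M := continuous f /\ supported_in_ball f M.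

Lemma integral_rVS n (f : 'rV[R]_n.+1 -> R) :
  integral_rV f = \int[@lebesgue_measure R]_t integral_rV (@slice n f t).
Proof. by []. Qed.

Lemma continuous_in_ball_lincomb n (f g : 'rV[R]_n -> R) M (c : R) :
  continuous_in_ball f M -> continuous_in_ball g M ->
  continuous_in_ball (fun x => c * f x + g x) M.
Proof.
move=> [cf fM] [cg gM]; split=> [x|x xM]; last by rewrite fM// gM// mulr0 addr0.
apply: (@continuousD R _ _ (fun y => c * f y) g x); last exact: cg.
by apply: (@continuousM R _ (cst c) f x); [exact: cst_continuous|exact: cf].
Qed.

(** The two properties go through the induction on the dimension together: integrability of t |->
    integral of the slice at t rests on its continuity, which uses linearity and the bound in one
    dimension less. *)
Definition linear_bounded n :=
  (forall (f g : 'rV[R]_n -> R) (M c : R),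
    continuous_in_ball f M -> continuous_in_ball g M ->
    integral_rV (fun x => c * f x + g x) = c * integral_rV f + integral_rV g) /\
  (forall (f : 'rV[R]_n -> R) (M B : R),
    0 < M -> continuous_in_ball f M -> (forall x, `|f x| <= B) ->
    `|integral_rV f| <= (2 * M) ^+ n * B).

Section dimension_step.
Variable n : nat.
Hypothesis lb : linear_bounded n.

Lemma integral_rV_0 : integral_rV (fun _ : 'rV[R]_n => 0 : R) = 0.
Proof.
have g0 : continuous_in_ball (fun _ : 'rV[R]_n => 0 : R) 1 by split=> // x; exact: cst_continuous.
apply/eqP; rewrite -normr_le0; have := lb.2 _ 1 0 ltr01 g0.
by rewrite mulr0; apply=> x; rewrite normr0.
Qed.

(** Nearby slices differ uniformly by at most e / D, where D = (2 M)^n is the constant of the bound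
    in dimension n. *)
Lemma integral_slice_continuous (f : 'rV[R]_(1 + n) -> R) M : 0 < M -> continuous_in_ball f M ->
  continuous (fun t => integral_rV (slice f t)).
Proof.
move=> M0 [cf fM] t; apply/cvgrPdist_le => e e0 /=.
pose D := (2 * M) ^+ n; have D0 : 0 < D by rewrite exprn_gt0// mulr_gt0.
have [d d0 dP] := uniform_modulus cf fM (divr_gt0 e0 D0).
near=> s.
have gs r : continuous_in_ball (slice f r) M.
  by split; [exact: slice_continuous|exact: slice_supported].
have -> : integral_rV (slice f t) - integral_rV (slice f s) =
    integral_rV (fun y => -1 * slice f s y + slice f t y).
  by rewrite (lb.1 _ _ M)// mulN1r addrC.
have -> : e = D * (e / D) by rewrite mulrC divfK// gt_eqF.
apply: (lb.2 _ M) => //; first exact: continuous_in_ball_lincomb.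
move=> y; rewrite mulN1r addrC; apply: dP.
rewrite opp_row_mx add_row_mx subrr -raddfN/= -raddfD/=.
apply: (@le_lt_trans _ _ `|t - s|); last first.
  by near: s; apply: cvgr_dist_lt => //; exact: cvg_id.
apply: norm_le_entries => // j; rewrite mxE; case: (fintype.split j) => a.
  by rewrite !ord1 mxE eqxx mulr1n.
by rewrite mxE normr0.
Unshelve. all: by end_near. Qed.

Lemma integral_slice_vanishes (f : 'rV[R]_(1 + n) -> R) M : continuous_in_ball f M ->
  vanishes_beyond M (fun t => integral_rV (slice f t)).
Proof. by move=> [_ fM] t Mt; rewrite (slice_eq0 Mt fM) integral_rV_0. Qed.

Lemma linear_boundedS : linear_bounded n.+1.
Proof.
split.
  move=> f g M c gf gg.
  (* Linearity is stated for M of any sign, whereas continuity of the slice integrals asks for a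
     positive radius; hence the passage to [|M| + 1]. *)
  have gW (h : 'rV[R]_n.+1 -> R) : continuous_in_ball h M -> continuous_in_ball h (`|M| + 1).
    by move=> [ch hM]; split=> // x xM; apply: hM; have := ler_norm M; lra.
  have M0 : 0 < `|M| + 1 by have := normr_ge0 M; lra.
  have {gf}gf := gW _ gf; have {gg gW}gg := gW _ gg.
  rewrite !integral_rVS.
  have If := integrable_vanishing (integral_slice_continuous M0 gf) (integral_slice_vanishes gf).
  have Ig := integrable_vanishing (integral_slice_continuous M0 gg) (integral_slice_vanishes gg).
  rewrite -RintegralZl// -RintegralD//; last first.
    have gcf : continuous_in_ball (fun x => c * f x + (fun=> 0) x) (`|M| + 1).
      apply: continuous_in_ball_lincomb => //; split=> // x; exact: cst_continuous.
    have := integrable_vanishing (integral_slice_continuous M0 gcf) (integral_slice_vanishes gcf).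
    congr (_.-integrable _ (EFin \o _)); apply/funext => t.
    transitivity (integral_rV (fun y => c * slice f t y + (fun=> 0) y)) => //.
    rewrite (lb.1 _ _ (`|M| + 1)) ?integral_rV_0 ?addr0//.
      by split; [apply: slice_continuous; case: gf|apply: slice_supported; case: gf].
    by split=> // x; exact: cst_continuous.
  apply: eq_Rintegral => t _; rewrite -(lb.1 _ _ (`|M| + 1))//.
    by split; [apply: slice_continuous; case: gf|apply: slice_supported; case: gf].
  by split; [apply: slice_continuous; case: gg|apply: slice_supported; case: gg].
move=> f M B M0 gf fB; rewrite integral_rVS exprS -mulrA.
apply: Rintegral_bound => //; first exact: ltW.
- exact: (integral_slice_continuous M0).
- exact: integral_slice_vanishes.
move=> t; apply: lb.2 => //.
  by split; [apply: slice_continuous; case: gf|apply: slice_supported; case: gf].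
by move=> y; exact: fB.
Qed.

End dimension_step.

Lemma integral_rV_linear_bounded n : linear_bounded n.
Proof.
elim: n => [|n IH]; last exact: linear_boundedS.
by split=> [//|f M B M0 _ fB]; rewrite expr0 mul1r; exact: fB.
Qed.

Lemma integral_rV_lincomb n (f g : 'rV[R]_n -> R) (M c : R) :
  continuous_in_ball f M -> continuous_in_ball g M ->
  integral_rV (fun x => c * f x + g x) = c * integral_rV f + integral_rV g.
Proof. exact: (integral_rV_linear_bounded n).1. Qed.

Lemma integral_rV_bound n (f : 'rV[R]_n -> R) (M B : R) :
  0 < M -> continuous_in_ball f M -> (forall x, `|f x| <= B) ->
  `|integral_rV f| <= (2 * M) ^+ n * B.
Proof. exact: (integral_rV_linear_bounded n).2. Qed.

Lemma continuous_in_ball_slice n (f : 'rV[R]_(1 + n) -> R) (M t : R) :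
  continuous_in_ball f M -> continuous_in_ball (slice f t) M.
Proof. by case=> cf fM; split; [exact: slice_continuous|exact: slice_supported]. Qed.

Lemma continuous_in_ball0 n (M : R) : continuous_in_ball (fun _ : 'rV[R]_n => 0 : R) M.
Proof. by split=> // x; exact: cst_continuous. Qed.

Lemma slice_quotient n (f : 'rV[R]_(1 + n) -> R) (t : R) (b : 'I_n) (y : 'rV[R]_n) :
  (fun h : R => h^-1 *: ((f \o shift (row_mx (t%:M : 'rV[R]_1) y))
     (h *: delta_mx 0 (rshift 1 b)) - f (row_mx (t%:M : 'rV[R]_1) y))) =
  (fun h : R => h^-1 *: ((slice f t \o shift y) (h *: delta_mx 0 b) - slice f t y)).
Proof. by apply/funext => h /=; rewrite row_mx_shift_r. Qed.

Lemma slice_pd n (f : 'rV[R]_(1 + n) -> R) (t : R) (b : 'I_n) :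
  slice (pd (rshift 1 b) f) t = pd b (slice f t).
Proof.
Transparent pd.
by apply/funext => y; rewrite /slice /pd /derive slice_quotient.
Opaque pd.
Qed.

Lemma derivable_slice n (f : 'rV[R]_(1 + n) -> R) (t : R) (b : 'I_n) (y : 'rV[R]_n) :
  derivable f (row_mx (t%:M : 'rV[R]_1) y) (delta_mx 0 (rshift 1 b)) ->
  derivable (slice f t) y (delta_mx 0 b).
Proof. by rewrite /derivable slice_quotient. Qed.

(** Differentiation under the integral sign. By the mean value theorem the difference quotient of f
    is its partial derivative at a point within |h|, so uniform continuity of that derivative bounds
    the error by e / D on the whole slice. *)
Lemma is_derive_slice n (f : 'rV[R]_(1 + n) -> R) (M t : R) :
  0 < M -> continuous_in_ball f M -> continuous_in_ball (pd (lshift n 0) f) M ->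
  (forall x, derivable f x (delta_mx 0 (lshift n 0))) ->
  is_derive t (1 : R) (fun s => integral_rV (slice f s))
    (integral_rV (slice (pd (lshift n 0) f) t)).
Proof.
move=> M0 gf gdf df; set v : 'rV[R]_(1 + n) := delta_mx 0 (lshift n 0).
pose F s := integral_rV (slice f s); pose G := integral_rV (slice (pd (lshift n 0) f) t).
suff H : h^-1 *: ((F \o shift t) (h *: 1) - F t) @[h --> 0^'] --> G.
  by split; [exact: cvgP H|exact: cvg_lim H].
apply/cvgrPdist_le => e e0.
pose D := (2 * M) ^+ n; have D0 : 0 < D by rewrite exprn_gt0// mulr_gt0.
have [d d0 dP] := uniform_modulus gdf.1 gdf.2 (divr_gt0 e0 D0).
near=> h.
have h0 : h != 0 by near: h; exact: nbhs_dnbhs_neq.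
have hd : `|h| < d by near: h; exact: dnbhs0_lt.
have gu : continuous_in_ball (fun y => -1 * slice f t y + slice f (h + t) y) M.
  by apply: continuous_in_ball_lincomb; exact: continuous_in_ball_slice.
have -> : G - h^-1 *: ((F \o shift t) (h *: 1) - F t) = integral_rV (fun y =>
    - h^-1 * (-1 * slice f t y + slice f (h + t) y) + slice (pd (lshift n 0) f) t y).
  rewrite (integral_rV_lincomb _ gu (continuous_in_ball_slice t gdf)).
  rewrite (integral_rV_lincomb _ (continuous_in_ball_slice t gf)
    (continuous_in_ball_slice (h + t) gf)).
  rewrite /= [h *: 1]mulr1 mulN1r addrC mulNr; congr (- (_ * _) + _).
  by rewrite addrC.
have -> : e = D * (e / D) by rewrite mulrC divfK// gt_eqF.
apply: (integral_rV_bound M0) => [|y].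
  by apply: continuous_in_ball_lincomb => //; exact: continuous_in_ball_slice.
pose x := row_mx (t%:M : 'rV[R]_1) y.
have [s _|c ch E] := @MVT_line R _ f x v h; first exact: df.
have -> : -1 * slice f t y + slice f (h + t) y = h * pd (lshift n 0) f (c *: v + x).
  by rewrite mulN1r addrC -[pd _ _ _]/('D_v f (c *: v + x)) -E /slice -row_mx_shift_l.
rewrite mulrA mulNr mulVf// mulN1r addrC; apply: dP.
rewrite opprD addrCA subrr addr0 normrN.
by apply: le_lt_trans hd; apply: le_trans ch; exact: norm_delta_mx.
Unshelve. all: by end_near. Qed.

(** For the first coordinate, the slice integrals of the derivative are the derivative of a
    compactly supported function of t, and the fundamental theorem of calculus gives 0. Any other
    coordinate is handled inside each slice by induction. *)
Lemma integral_rV_pd n (f : 'rV[R]_n -> R) (M : R) (b : 'I_n) :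
  0 < M -> continuous_in_ball f M -> continuous_in_ball (pd b f) M ->
  (forall x, derivable f x (delta_mx 0 b)) ->
  integral_rV (pd b f) = 0.
Proof.
elim: n f b => [f [] //|n IH] f b M0 gf gdf df.
rewrite integral_rVS.
have lbn := integral_rV_linear_bounded n.
case: (fintype.splitP (b : 'I_(1 + n))) => b' bb'.
  have bl : b = lshift n (0 : 'I_1) by apply: val_inj; rewrite /= bb' ord1.
  rewrite {}bl in gdf df *.
  apply: (Rintegral_derivative M0 _ (fun t => is_derive_slice t M0 gf gdf df)).
    exact: (integral_slice_continuous lbn M0 gdf).
  exact: (integral_slice_vanishes lbn gf).
have br : b = rshift 1 b' by apply: val_inj; rewrite /= bb'.
rewrite {}br in gdf df *.
rewrite (@eq_Rintegral _ _ _ _ _ (fun=> 0)).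
  by rewrite Rintegral_cst// mul0r.
move=> t _; rewrite slice_pd; apply: IH => //; first exact: continuous_in_ball_slice.
  by rewrite -slice_pd; exact: continuous_in_ball_slice.
by move=> y; exact: derivable_slice.
Qed.

End iterated_integral.

(** * Test functions on an open set and the integral over the plane of tangential coordinates *)

Section test_functions.
Context {R : realType}.

(** A and the complement of K form an open cover, and h is 0 on the latter. *)
Lemma smooth_glue n (A K : set 'rV[R]_n) h : open A -> closed K -> K `<=` A ->
  smooth A h -> (forall x, ~ K x -> h x = 0) -> smooth setT h.
Proof.
move=> oA cK KA [sh] h0.
have [shK] : smooth (~` K) h.
  have oK : open (~` K) by exact: closed_openC.
  apply: (smooth_ext oK _ (smooth_cst oK 0)) => x /= nKx.
  by rewrite h0.
by split=> e x _; case: (pselect (K x)) => [/KA|] Kx; [exact: sh|exact: shK].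
Qed.

(** A compact K that carries f replaces the support itself: the same K serves products and
    derivatives, unions serve sums, and images serve pull-backs, without computing closures. *)
Definition test_in n (A : set 'rV[R]_n) (f : 'rV[R]_n -> R) :=
  smooth setT f /\
  exists K, [/\ compact K, K `<=` A & forall x, ~ K x -> f x = 0].

Variables (n : nat) (A : set 'rV[R]_n).
Hypothesis oA : open A.

Lemma test_in_smooth f (U : set 'rV[R]_n) : test_in A f -> smooth U f.
Proof. by case=> sf _; exact: smoothS sf. Qed.

Lemma test_in_outside f x : test_in A f -> ~ A x -> f x = 0.
Proof. by move=> [_ [K [_ KA f0]]] Ax; apply: f0 => /KA. Qed.

Lemma test_inM g f : smooth A g -> test_in A f -> test_in A (fun x => g x * f x).
Proof.
move=> sg tf; have [_ [K [cK KA f0]]] := tf.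
have gf0 x : ~ K x -> g x * f x = 0 by move=> /f0 ->; rewrite mulr0.
split; last by exists K.
apply: (smooth_glue oA _ KA) gf0.
  by apply: compact_closed cK; exact: norm_hausdorff.
by apply: smoothM => //; exact: test_in_smooth.
Qed.

Lemma test_in_pd i f : test_in A f -> test_in A (pd i f).
Proof.
move=> [sf [K [cK KA f0]]]; split; first exact: smooth_pd.
exists K; split=> // x Kx.
have oK : open (~` K).
  by apply: closed_openC; apply: compact_closed cK; exact: norm_hausdorff.
rewrite (pd_ext _ oK (g := fun=> 0))// ?pd_cst// => y Ky; exact: f0.
Qed.

Lemma test_in_partials e f : test_in A f -> test_in A (partials e f).
Proof.
by move=> tf; elim: e => [//|i e IH]; rewrite partials_cons; exact: test_in_pd.
Qed.

Lemma test_in0 : test_in A (fun=> 0).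
Proof. by split; [exact: (smooth_cst openT)|exists set0; split => //; exact: compact0]. Qed.

Lemma test_inD f g : test_in A f -> test_in A g -> test_in A (fun x => f x + g x).
Proof.
move=> [sf [K [cK KA f0]]] [sg [K' [cK' KA' g0]]].
split; first exact: (smoothD openT).
exists (K `|` K'); split; first exact: compactU.
  by move=> x [/KA|/KA'].
by move=> x /not_orP[/f0 -> /g0 ->]; rewrite addr0.
Qed.

Lemma test_in_sum (I : Type) (r : seq I) (F : I -> 'rV[R]_n -> R) :
  (forall a, test_in A (F a)) -> test_in A (fun x => \sum_(a <- r) F a x).
Proof.
move=> tF; elim: r => [|a r IH].
  by under eq_fun do rewrite big_nil; exact: test_in0.
by under eq_fun do rewrite big_cons; exact: (test_inD (tF a) IH).
Qed.

Lemma test_in_bounded f : test_in A f -> exists2 M : R, 0 < M & supported_in_ball f M.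
Proof.
move=> [_ [K [cK _ f0]]]; have [M [_ KM]] := compact_bounded cK.
exists (`|M| + 1); first by have := normr_ge0 M; lra.
move=> x xM; apply: f0 => Kx.
have : `|x| <= `|M| + 1 by apply: KM => //; have := ler_norm M; lra.
by rewrite leNgt xM.
Qed.

End test_functions.

Lemma supported_in_ballW (R : realType) n (f : 'rV[R]_n -> R) (M M' : R) :
  M <= M' -> supported_in_ball f M -> supported_in_ball f M'.
Proof. by move=> MM fM x /(le_lt_trans MM); exact: fM. Qed.

Section surface_integral.
Context {R : realType} {k m : nat}.
Implicit Types (f g : 'rV[R]_(k + m) -> R).

Definition surface_integral f : R := integral_rV (fun y : 'rV[R]_m => f (row_mx 0 y)).

Lemma norm_row_mx0 (y : 'rV[R]_m) : `|y| <= `|row_mx (0 : 'rV[R]_k) y|.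
Proof.
apply: norm_le_entries => // j.
rewrite -(row_mxEr (0 : 'rV[R]_k)); exact: entry_le_norm.
Qed.

Lemma row_mx0_shift (h : R) (y : 'rV[R]_m) (b : 'I_m) :
  h *: delta_mx 0 (rshift k b) + row_mx (0 : 'rV[R]_k) y =
  row_mx 0 (h *: delta_mx 0 b + y).
Proof.
apply/rowP => j; rewrite !mxE; case: splitP => [j' jj'|j' jj'].
  rewrite (_ : (j == rshift k b) = false) ?andbF ?mulr0 ?add0r//.
  by apply/eqP => jl; have := ltn_ord j'; rewrite -jj' jl /= ltnNge leq_addr.
have -> : j = rshift k j' by apply: val_inj.
by rewrite !mxE (inj_eq (@rshift_inj _ _)).
Qed.

Lemma row_mx0_quotient f (b : 'I_m) (y : 'rV[R]_m) :
  (fun h : R => h^-1 *: ((f \o shift (row_mx 0 y)) (h *: delta_mx 0 (rshift k b))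
    - f (row_mx 0 y))) =
  (fun h : R => h^-1 *: (((fun z => f (row_mx 0 z)) \o shift y) (h *: delta_mx 0 b)
    - f (row_mx 0 y))).
Proof. by apply/funext => h /=; rewrite row_mx0_shift. Qed.

Lemma pd_row_mx0 f (b : 'I_m) (y : 'rV[R]_m) :
  pd (rshift k b) f (row_mx 0 y) = pd b (fun z => f (row_mx 0 z)) y.
Proof.
Transparent pd.
by rewrite /pd /derive row_mx0_quotient.
Opaque pd.
Qed.

Lemma row_mx0_continuous : continuous (fun y : 'rV[R]_m => row_mx (0 : 'rV[R]_k) y).
Proof.
move=> y; apply: continuous_mx => i j.
rewrite (_ : (fun z : 'rV[R]_m => (row_mx (0 : 'rV[R]_k) z : 'rV[R]_(k + m)) i j) = fun z =>
  match fintype.split j with inl a => 0 | inr a => z i a end); last first.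
  by apply/funext => z; rewrite mxE; case: (fintype.split j) => a; rewrite ?mxE.
case: (fintype.split j) => a; first exact: cst_continuous.
exact: coord_continuous.
Qed.

Lemma continuous_in_ball_surface f (M : R) : smooth setT f -> supported_in_ball f M ->
  continuous_in_ball (fun y : 'rV[R]_m => f (row_mx 0 y)) M.
Proof.
move=> sf fM; split=> [y|y yM]; last first.
  by apply: fM; exact: lt_le_trans yM (norm_row_mx0 y).
apply: (@continuous_comp _ _ _ (fun y => row_mx (0 : 'rV[R]_k) y) f).
  exact: row_mx0_continuous.
exact: (smooth_continuous sf).
Qed.

Variable A : set 'rV[R]_(k + m).

Lemma surface_integralD f g : test_in A f -> test_in A g ->
  surface_integral (fun x => f x + g x) = surface_integral f + surface_integral g.
Proof.
move=> tf tg; rewrite /surface_integral.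
have [M M0 fM] := test_in_bounded tf.
have [M' M'0 gM] := test_in_bounded tg.
have MM : M <= M + M' by lra.
have MM' : M' <= M + M' by lra.
rewrite -[X in X + _]mul1r -(integral_rV_lincomb _ (M := M + M')).
- by congr integral_rV; apply/funext => y; rewrite mul1r.
- exact: continuous_in_ball_surface (test_in_smooth setT tf) (supported_in_ballW MM fM).
- exact: continuous_in_ball_surface (test_in_smooth setT tg) (supported_in_ballW MM' gM).
Qed.

Lemma surface_integral_sum (I : Type) (r : seq I) (F : I -> 'rV[R]_(k + m) -> R) :
  (forall a, test_in A (F a)) ->
  surface_integral (fun x => \sum_(a <- r) F a x) = \sum_(a <- r) surface_integral (F a).
Proof.
move=> tF; elim: r => [|a r IH].
  under eq_fun do rewrite big_nil; rewrite big_nil.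
  exact: (integral_rV_0 (integral_rV_linear_bounded m)).
under eq_fun do rewrite big_cons; rewrite big_cons -IH surface_integralD//.
exact: test_in_sum.
Qed.

Lemma surface_integralZ (c : R) f : test_in A f ->
  surface_integral (fun x => c * f x) = c * surface_integral f.
Proof.
move=> tf; have [M M0 fM] := test_in_bounded tf; rewrite /surface_integral.
have gf := continuous_in_ball_surface (test_in_smooth setT tf) fM.
have := integral_rV_lincomb c gf (continuous_in_ball0 _ M).
rewrite (integral_rV_0 (integral_rV_linear_bounded m)) addr0 => <-.
by congr integral_rV; apply/funext => y; rewrite addr0.
Qed.

Lemma surface_integral_pd f (b : 'I_m) : test_in A f ->
  surface_integral (pd (rshift k b) f) = 0.
Proof.
move=> tf; have [M M0 fM] := test_in_bounded tf.
have [M' M'0 fM'] := test_in_bounded (test_in_pd (rshift k b) tf).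
have MM : M <= M + M' by lra.
have MM' : M' <= M + M' by lra.
have sf := test_in_smooth setT tf.
have E : (fun y : 'rV[R]_m => pd (rshift k b) f (row_mx 0 y)) =
    pd b (fun y => f (row_mx 0 y)).
  by apply/funext => y; exact: pd_row_mx0.
rewrite /surface_integral E; apply: (@integral_rV_pd _ _ _ (M + M')).
- lra.
- exact: continuous_in_ball_surface sf (supported_in_ballW MM fM).
- rewrite -E; exact: continuous_in_ball_surface (smooth_pd _ sf) (supported_in_ballW MM' fM').
- move=> y.
  have : derivable f (row_mx 0 y) (delta_mx 0 (rshift k b)).
    exact: (diff_derivable (smooth_differentiable openT sf I)).
  by rewrite /derivable row_mx0_quotient.
Qed.

Lemma eq_surface_integral f g :
  (forall y, A (row_mx 0 y) -> f (row_mx 0 y) = g (row_mx 0 y)) ->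
  (forall x, ~ A x -> f x = 0) -> (forall x, ~ A x -> g x = 0) ->
  surface_integral f = surface_integral g.
Proof.
move=> fg f0 g0; congr integral_rV; apply/funext => y.
by case: (pselect (A (row_mx 0 y))) => Ay; [exact: fg|rewrite f0 ?g0].
Qed.

End surface_integral.

(** * Change of variables *)

Section change_of_variables.
Context {R : realType} {n : nat}.
Variables (A B : set 'rV[R]_n) (psi chi : 'rV[R]_n -> 'rV[R]_n).
Hypotheses (oA : open A) (oB : open B) (spsi : smoothmx B psi) (schi : smoothmx A chi)
  (psiA : forall v, B v -> A (psi v)) (chiB : forall u, A u -> B (chi u))
  (psiK : forall v, B v -> chi (psi v) = v) (chiK : forall u, A u -> psi (chi u) = u).

(** Row i holds the derivatives in direction i, as in ['J], so the chain rule multiplies the matrix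
    of the inner map on the left. *)
Definition jacobi_mx (f : 'rV[R]_n -> 'rV[R]_n) (v : 'rV[R]_n) : 'M[R]_n :=
  \matrix_(i, c) pd i (fun w => f w 0 c) v.

Lemma jacobianE_mx f (U : set 'rV[R]_n) v : open U -> smoothmx U f -> U v ->
  'J f v = jacobi_mx f v.
Proof.
move=> oU sf Uv; apply/matrixP => i c; rewrite jacobianE ?mxE//.
exact: (smoothmx_differentiable oU sf).
Qed.

Lemma pd_smooth_comp i (f : 'rV[R]_n -> R) v : smooth A f -> B v ->
  pd i (fun w => f (psi w)) v =
  \sum_c pd c f (psi v) * pd i (fun w => psi w 0 c) v.
Proof.
move=> sf Bv; apply: pd_comp => [|c].
  exact: (smooth_differentiable oA sf (psiA Bv)).
exact: (smooth_differentiable oB (smooth_entry 0 c spsi)).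
Qed.

Lemma smooth_comp_psi f : smooth A f -> smooth B (fun v => f (psi v)).
Proof. by move=> sf; apply: (smooth_comp oB oA psiA). Qed.

Lemma smooth_comp_chi f : smooth B f -> smooth A (fun u => f (chi u)).
Proof. by move=> sf; apply: (smooth_comp oA oB chiB). Qed.

Lemma smooth_jacobi_mx : smoothmx B (jacobi_mx psi).
Proof.
apply/smoothmxP => i c; apply: (smooth_ext oB _ (smooth_pd i (smooth_entry 0 c spsi))).
by move=> v _; rewrite mxE.
Qed.

Lemma jacobi_mxV v : B v -> jacobi_mx psi v *m jacobi_mx chi (psi v) = 1%:M.
Proof.
move=> Bv; apply/matrixP => i c; rewrite !mxE.
transitivity (pd i (fun w => chi (psi w) 0 c) v).
  rewrite (@pd_smooth_comp i (fun u => chi u 0 c))//; last exact: smooth_entry.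
  by apply: eq_bigr => d _; rewrite !mxE mulrC.
rewrite (pd_ext _ oB (g := fun w => w 0 c))// ?pd_coord//.
by move=> w Bw; rewrite psiK.
Qed.

(** The pull-back of the n-form F du, with the signed Jacobian; the extension by 0 mirrors
    [in_chart]. *)
Definition pullback (F : 'rV[R]_n -> R) : 'rV[R]_n -> R :=
  patch (fun=> 0) B (fun v => F (psi v) * \det (jacobi_mx psi v)).

Lemma pullbackE F v : B v -> pullback F v = F (psi v) * \det (jacobi_mx psi v).
Proof. by move=> Bv; rewrite /pullback patchE mem_set. Qed.

Lemma pullback_out F v : ~ B v -> pullback F v = 0.
Proof. by move=> Bv; rewrite /pullback patchE memNset. Qed.

Lemma test_in_pullback F : test_in A F -> test_in B (pullback F).
Proof.
move=> tF; have [sF [K [cK KA F0]]] := tF.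
have cpsiK : compact (chi @` K).
  apply: continuous_compact cK; apply: continuous_in_subspaceT => x /set_mem /KA Ax.
  exact: smoothmx_continuous schi Ax.
have pF0 v : ~ (chi @` K) v -> pullback F v = 0.
  move=> Kv; case: (pselect (B v)) => Bv; last exact: pullback_out.
  rewrite pullbackE// F0 ?mul0r// => Kpv.
  by apply: Kv; exists (psi v) => //; rewrite psiK.
have KB : chi @` K `<=` B by move=> _ [u /KA Au <-]; exact: chiB.
split; last by exists (chi @` K).
apply: (smooth_glue oB _ KB) pF0.
  by apply: compact_closed cpsiK; exact: norm_hausdorff.
apply: (smooth_ext oB (f := fun v => F (psi v) * \det (jacobi_mx psi v))).
  by move=> v Bv; rewrite pullbackE.
apply: smoothM => //; last exact: smooth_det smooth_jacobi_mx.
by apply: smooth_comp_psi; exact: test_in_smooth tF.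
Qed.

Variable l : 'I_n.

(* The coordinate field d/dv_l, in the coordinates u = psi v. *)
Definition coordinate_field (u : 'rV[R]_n) : 'rV[R]_n :=
  \row_c pd l (fun w => psi w 0 c) (chi u).

Lemma smooth_coordinate_field : smoothmx A coordinate_field.
Proof.
apply/smoothmxP => i c; rewrite ord1.
apply: (smooth_ext oA _ (smooth_comp_chi (smooth_pd l (smooth_entry 0 c spsi)))).
by move=> u _; rewrite mxE.
Qed.

End change_of_variables.

Section piola.
Context {R : realType} {n : nat}.
Variables (A B : set 'rV[R]_n) (psi chi : 'rV[R]_n -> 'rV[R]_n).
Hypotheses (oA : open A) (oB : open B) (spsi : smoothmx B psi) (schi : smoothmx A chi)
  (psiA : forall v, B v -> A (psi v)) (chiB : forall u, A u -> B (chi u))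
  (psiK : forall v, B v -> chi (psi v) = v) (chiK : forall u, A u -> psi (chi u) = u).

(** Jacobi's formula gives the derivative of the Jacobian as det J times the sum of the entries of
    J^-1 against d_l d_i psi_c. Since mixed partials commute, this is the sum of d_i d_l psi_c
    against the same entries, and by the chain rule that sum is the divergence of the field d/dv_l
    in the coordinates u. *)
Lemma pd_pullback l F v : smooth A F -> B v ->
  pd l (pullback B psi F) v =
  (\sum_c pd c (fun u => coordinate_field psi chi l u 0 c * F u) (psi v))
  * \det (jacobi_mx psi v).
Proof.
move=> sF Bv.
have sX := smooth_coordinate_field oA oB spsi schi chiB l.
have sD := smooth_det oB (smooth_jacobi_mx oB spsi).
have sFp := smooth_comp_psi oA oB spsi psiA sF.
rewrite (pd_ext l oB (g := fun w => F (psi w) * \det (jacobi_mx psi w)))//; last first.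
  by move=> w Bw; rewrite pullbackE.
rewrite (spdM oB)// (pd_smooth_comp oA oB spsi psiA)//.
rewrite (@pd_det_inverse _ _ _ l (jacobi_mx psi) (jacobi_mx chi (psi v))); last first.
- exact: (jacobi_mxV oA oB spsi schi psiA).
- move=> i c; exact: (smooth_differentiable oB (smooth_entry i c (smooth_jacobi_mx oB spsi))).
rewrite [F (psi v) * _]mulrCA [_ * (F (psi v) * _)]mulrC -mulrDl.
apply: (congr1 (fun z => z * \det (jacobi_mx psi v))).
under [RHS]eq_bigr => c _.
  rewrite (spdM oA c (smooth_entry 0 c sX) sF (psiA Bv)).
  over.
rewrite big_split/= addrC; apply: (f_equal2 +%R).
  by apply: eq_bigr => c _; rewrite mxE psiK// mulrC.
rewrite -mulr_suml mulrC; apply: (congr1 (fun z => z * F (psi v))).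
rewrite exchange_big/=; apply: eq_bigr => c _.
pose g := pd l (fun w => psi w 0 c).
have sg : smooth B g by apply: smooth_pd; exact: smooth_entry.
rewrite (pd_ext c oA (g := fun u => g (chi u)))//; last 2 first.
- by move=> u _; rewrite mxE.
- exact: psiA.
rewrite (pd_smooth_comp oB oA schi chiB)//; last exact: psiA.
apply: eq_bigr => i _; rewrite mxE mulrC psiK//.
apply: (congr1 (fun z => z * _)).
apply: etrans (pdC l i oB (smooth_entry 0 c spsi) Bv).
by apply: (pd_ext l oB _ Bv) => w _; rewrite mxE.
Qed.

End piola.

(** * Two coordinate systems that agree on the surface *)

Section adapted_coordinates.
Context {R : realType} {k m : nat}.
Local Notation pt := 'rV[R]_(k + m).
Variables (A B : set pt) (psi chi : pt -> pt) (a b : pt -> 'M[R]_k).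
Hypotheses (oA : open A) (oB : open B) (spsi : smoothmx B psi) (schi : smoothmx A chi)
  (psiA : forall v, B v -> A (psi v)) (chiB : forall u, A u -> B (chi u))
  (psiK : forall v, B v -> chi (psi v) = v) (chiK : forall u, A u -> psi (chi u) = u)
  (sa : smoothmx A a) (sb : smoothmx A b)
  (ba1 : forall u, A u -> b u *m a u = 1%:M)
  (psi_normal : forall v, B v -> forall j,
     psi v 0 (lshift m j) = \sum_i v 0 (lshift m i) * b (psi v) i j)
  (chi_normal : forall u, A u -> forall j,
     chi u 0 (lshift m j) = \sum_i u 0 (lshift m i) * a u i j)
  (AB0 : forall y, A (row_mx 0 y) <-> B (row_mx 0 y))
  (psi0 : forall y, B (row_mx 0 y) -> psi (row_mx 0 y) = row_mx 0 y).

Lemma normal_row_mx0 (y : 'rV[R]_m) i : row_mx (0 : 'rV[R]_k) y 0 (lshift m i) = 0.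
Proof. by rewrite row_mxEl mxE. Qed.

Section field.
Variable l : 'I_k.
Let X := coordinate_field psi chi (lshift m l).

(** The matrix C = a X(b) of the overview. *)
Definition drift (u : pt) : 'M[R]_k :=
  a u *m \matrix_(i, j) along X (fun w => b w i j) u.

Let sX : smoothmx A X.
Proof. exact: (smooth_coordinate_field oA oB spsi schi chiB (lshift m l)). Qed.

Lemma smooth_along_b i j : smooth A (along X (fun w => b w i j)).
Proof. by apply: (smooth_along oA sX); exact: smooth_entry. Qed.

Lemma smooth_drift : smoothmx A drift.
Proof.
apply/smoothmxP => i j.
apply: (smooth_ext oA (f := fun u => \sum_c a u i c * along X (fun w => b w c j) u)).
  by move=> u _; rewrite mxE; apply: eq_bigr => c _; rewrite mxE.
apply: (smooth_sum oA) => c.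
by apply: (smoothM oA); [exact: smooth_entry|exact: smooth_along_b].
Qed.

(** Leibniz on u = v b: the derivative of v_i selects row l of b, and by the chain rule d/dv_l of b
    o psi is X(b) taken at psi v. *)
Lemma pd_psi_normal v c : B v ->
  pd (lshift m l) (fun w => psi w 0 (lshift m c)) v =
  b (psi v) l c + \sum_i v 0 (lshift m i) * along X (fun w => b w i c) (psi v).
Proof.
move=> Bv.
have sbp i : smooth B (fun w => b (psi w) i c).
  by apply: (smooth_comp_psi oA oB spsi psiA (f := fun u => b u i c)); exact: smooth_entry.
rewrite (pd_ext _ oB (g := fun w => \sum_i w 0 (lshift m i) * b (psi w) i c))//; last first.
  by move=> w Bw; rewrite psi_normal.
rewrite (spd_sum oB)//; last first.
  by move=> i; apply: (smoothM oB) => //; exact: smooth_coord.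
under eq_bigr => i _.
  rewrite (spdM oB _ (smooth_coord oB _) (sbp i) Bv) pd_coord (inj_eq (@lshift_inj _ _)).
  over.
rewrite big_split/=; apply: (f_equal2 +%R).
  rewrite (bigD1 l)//= eqxx mul1r big1 ?addr0// => i il.
  by rewrite eq_sym (negbTE il) mul0r.
apply: eq_bigr => i _; apply: (congr1 (fun z => _ * z)).
rewrite (pd_smooth_comp oA oB spsi psiA (lshift m l) (smooth_entry i c sb) Bv).
by apply: eq_bigr => d _; rewrite /X mxE psiK// mulrC.
Qed.

(** Substituting v = u a into [pd_psi_normal] collects a X(b) as the coefficient of u. *)
Lemma field_normal u : A u -> forall c,
  X u 0 (lshift m c) = b u l c + \sum_j u 0 (lshift m j) * drift u j c.
Proof.
move=> Au c; rewrite /X mxE pd_psi_normal ?chiK//; last exact: chiB.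
apply: (congr1 (fun z => _ + z)).
under eq_bigr => i _ do rewrite chi_normal// mulr_suml.
rewrite exchange_big/=; apply: eq_bigr => j _.
rewrite mxE mulr_sumr; apply: eq_bigr => i _; rewrite mxE mulrA.
by [].
Qed.

Lemma b_drift u : A u -> forall i c,
  \sum_j b u i j * drift u j c = along X (fun w => b w i c) u.
Proof.
move=> Au i c.
transitivity ((b u *m drift u) i c); first by rewrite mxE.
by rewrite /drift mulmxA ba1// mul1mx mxE.
Qed.

(** Jacobi's formula with inverse a, summed against the components of X, yields the trace of a
    X(b). *)
Lemma along_det_b u : A u -> along X (fun w => \det (b w)) u = \det (b u) * \tr (drift u).
Proof.
move=> Au; rewrite /along.
under eq_bigr => c _.
  rewrite (@pd_det_inverse _ _ _ c b (a u)) ?ba1//; last first.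
    by move=> i j; exact: (smooth_differentiable oA (smooth_entry i j sb)).
  rewrite mulrCA; over.
rewrite -mulr_sumr; apply: (congr1 (fun z => _ * z)).
transitivity (\sum_i \sum_j a u j i * along X (fun w => b w i j) u).
  under eq_bigr => c _ do rewrite mulr_sumr.
  rewrite exchange_big/=; apply: eq_bigr => i _.
  under eq_bigr => c _ do rewrite mulr_sumr.
  rewrite exchange_big/=; apply: eq_bigr => j _.
  by rewrite /along mulr_sumr; apply: eq_bigr => c _; rewrite mulrCA.
rewrite exchange_big/=; apply: eq_bigr => j _.
by rewrite mxE; apply: eq_bigr => i _; rewrite mxE.
Qed.

End field.

(** Where v_1 = ... = v_k = 0 the Jacobian matrix is block triangular. The normal rows start with b,
    since the other terms carry a factor v_i; the tangential rows are (0 | 1), since psi fixes the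
    points of the plane. *)
Lemma det_jacobi_row_mx0 y : B (row_mx 0 y) ->
  \det (jacobi_mx psi (row_mx 0 y)) = \det (b (row_mx 0 y)).
Proof.
move=> By.
have nB : \forall z \near y, B (row_mx 0 z).
  exact: row_mx0_continuous (open_near oB By).
suff -> : jacobi_mx psi (row_mx 0 y) = block_mx (b (row_mx 0 y))
    (ursubmx (jacobi_mx psi (row_mx 0 y))) 0 1%:M.
  by rewrite det_ublock det1 mulr1.
rewrite -[LHS]submxK; congr block_mx.
- apply/matrixP => i j; rewrite !mxE pd_psi_normal// psi0// big1 ?addr0// => c _.
  by rewrite normal_row_mx0 mul0r.
- apply/matrixP => i j; rewrite !mxE pd_row_mx0.
  rewrite (near_pd _ (g := fun=> 0)) ?pd_cst//.
  apply: filterS nB => z Bz; rewrite psi0//; exact: normal_row_mx0.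
- apply/matrixP => i j; rewrite !mxE pd_row_mx0.
  rewrite (near_pd _ (g := fun z => z 0 j)) ?pd_coord//.
  by apply: filterS nB => z Bz; rewrite psi0// row_mxEr.
Qed.

Lemma test_in_weighted_partials I H : test_in A H -> test_in A (weighted_partials b I H).
Proof.
elim: I H => [//|i I IH] H tH /=.
apply: test_in_sum => j; apply: test_in_pd; apply: IH.
by apply: (test_inM oA) => //; exact: smooth_entry.
Qed.

Lemma test_in_divergence X H : smoothmx A X -> test_in A H -> test_in A (divergence X H).
Proof.
move=> sX tH; apply: test_in_sum => c; apply: test_in_pd.
by apply: (test_inM oA) => //; exact: smooth_entry.
Qed.

(** Moves the outermost derivative innermost, next to the pull-back, where the Piola identity can
    absorb it. *)
Lemma partials_pdC n e i (f : 'rV[R]_n -> R) : smooth setT f ->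
  pd i (partials e f) = partials e (pd i f).
Proof.
move=> sf; elim: e => [//|j e IH]; rewrite !partials_cons -IH; apply/funext => x.
apply: (pdC _ _ openT _ (I : [set: 'rV[R]_n] x)).
by elim: e {IH} => [//|c e IH]; rewrite partials_cons; exact: smooth_pd.
Qed.

(** Both sides are 0 outside B, so the equality holds between functions on the whole space and can
    be used under further derivatives. *)
Lemma pullback_divergence l F : test_in A F ->
  pd (lshift m l) (pullback B psi F) =
  pullback B psi (divergence (coordinate_field psi chi (lshift m l)) F).
Proof.
move=> tF; apply/funext => v; case: (pselect (B v)) => Bv.
  rewrite pullbackE// (pd_pullback oA oB spsi schi psiA chiB psiK)//.
  exact: test_in_smooth tF.
rewrite pullback_out//; apply: test_in_outside Bv; apply: test_in_pd.
exact: (test_in_pullback oA oB spsi schi psiA chiB psiK tF).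
Qed.

(** Induction on I for all F: one derivative of the pull-back replaces F by div (X F), to which the
    induction hypothesis applies. With no derivative left, psi is the identity on the plane and the
    Jacobian there is det b. *)
Lemma surface_integral_pullback (I : seq 'I_k) F : test_in A F ->
  surface_integral (partials (map (lshift m) I) (pullback B psi F)) =
  surface_integral (weighted_partials b I (fun u => \det (b u) * F u)).
Proof.
have sdet := smooth_det oA sb.
elim: I F => [|l I IH] F tF.
  congr integral_rV; apply/funext => y /=.
  case: (pselect (A (row_mx 0 y))) => Ay; last first.
    by rewrite (test_in_outside tF Ay) mulr0 pullback_out// -AB0.
  have By : B (row_mx 0 y) by rewrite -AB0.
  by rewrite pullbackE// psi0// det_jacobi_row_mx0// mulrC.
set X := coordinate_field psi chi (lshift m l).
have sX : smoothmx A X by exact: (smooth_coordinate_field oA oB spsi schi chiB).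
have tp := test_in_pullback oA oB spsi schi psiA chiB psiK tF.
rewrite map_cons partials_cons partials_pdC; last exact: test_in_smooth tp.
rewrite pullback_divergence// IH; last exact: test_in_divergence.
have tH : test_in A (fun u => \det (b u) * F u) by apply: (test_inM oA).
set H := fun u => _ in tH *.
have tXH c : test_in A (weighted_partials b I (fun y => X y 0 (rshift k c) * H y)).
  apply: test_in_weighted_partials; apply: (test_inM oA) => //; exact: smooth_entry.
transitivity (surface_integral (fun u => weighted_partials b (l :: I) H u +
    \sum_(c < m) pd (rshift k c) (weighted_partials b I (fun y => X y 0 (rshift k c) * H y)) u)).
  apply: (eq_surface_integral (A := A)).
  - move=> y Ay.
    (* With H = det b F, Leibniz gives det b div (X F) = div (X H) - X(det b) F, and X(det b) F = tr
       C H by [along_det_b]. *)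
    transitivity (weighted_partials b I (reduced_divergence (drift l) X H) (row_mx 0 y)).
      apply: (weighted_partials_ext _ oA) Ay => u Au.
      rewrite /reduced_divergence (divergenceM oA sX)//; last exact: test_in_smooth tF.
      rewrite (along_det_b _ Au)/H; ring.
    rewrite (weighted_partials_reduced_divergence oA sb (smooth_drift l) sX
      (field_normal l) (b_drift l))//.
      apply: (congr1 (fun z => z + _)); rewrite big1 ?addr0// => j _.
      by rewrite normal_row_mx0 mul0r.
    exact: test_in_smooth tH.
  - move=> x; apply: test_in_outside; apply: test_in_weighted_partials; apply: (test_inM oA) => //.
    exact: test_in_divergence.
  - move=> x Ax; rewrite (test_in_outside (test_in_weighted_partials _ tH) Ax) add0r big1// => c _.
    exact: (test_in_outside (test_in_pd _ (tXH c)) Ax).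
rewrite (surface_integralD (A := A)); last 2 first.
- exact: test_in_weighted_partials.
- by apply: test_in_sum => c; exact: test_in_pd.
have -> := surface_integral_sum (index_enum 'I_m) (fun c => test_in_pd (rshift k c) (tXH c)).
by rewrite big1 ?addr0// => c _; rewrite (surface_integral_pd (A := A)).
Qed.

End adapted_coordinates.

(** * Expansion over multi-indices *)

Lemma big_tuple_cons (V : nmodType) (T : finType) s (F : s.+1.-tuple T -> V) :
  \sum_(J : s.+1.-tuple T) F J = \sum_(j : T) \sum_(J : s.-tuple T) F [tuple of j :: J].
Proof.
rewrite pair_big/= (reindex (fun p : T * s.-tuple T => [tuple of p.1 :: p.2]))//.
exists (fun J : s.+1.-tuple T => (thead J, [tuple of behead J])) => [[j J] _|J _] /=.
  by rewrite theadE; congr (_, _); apply: val_inj.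
by rewrite [RHS](tuple_eta J).
Qed.

Section weighted_partials_tuple.
Context {R : realType} {k m : nat} (A : set 'rV[R]_(k + m)) (b : 'rV[R]_(k + m) -> 'M[R]_k).
Hypotheses (oA : open A) (sb : smoothmx A b).

Lemma test_in_prod_entries s (I J : s.-tuple 'I_k) H : test_in A H ->
  test_in A (fun u => \prod_(a < s) b u (tnth I a) (tnth J a) * H u).
Proof.
move=> tH; apply: (test_inM oA _ tH).
by apply: (smooth_prod oA) => a; exact: smooth_entry.
Qed.

(** The recursion multiplies H by a weight before differentiating, so all weights gather in one
    product inside the derivatives. This is the shape of a product of a smooth function with
    delta_J(P). *)
Lemma weighted_partialsE s (I : s.-tuple 'I_k) H : test_in A H ->
  weighted_partials b I H = fun x => \sum_(J : s.-tuple 'I_k)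
    partials (map (lshift m) J)
      (fun u => \prod_(a < s) b u (tnth I a) (tnth J a) * H u) x.
Proof.
elim: s I H => [|s IH] I H tH.
  apply/funext => x; rewrite (big_pred1 [tuple])/=; last by move=> J; rewrite [J]tuple0.
  by rewrite [I]tuple0 /= big_ord0 mul1r.
case/tupleP: I => i I; apply/funext => x.
rewrite big_tuple_cons.
transitivity (\sum_(j < k) pd (lshift m j)
  (weighted_partials b I (fun u => b u i j * H u)) x) => //.
apply: eq_bigr => j _.
have tbH : test_in A (fun u => b u i j * H u).
  by apply: (test_inM oA _ tH); exact: smooth_entry.
rewrite IH// (spd_sum openT)//; last first.
  move=> J; apply: (test_in_smooth (A := A)); apply: test_in_partials.
  exact: test_in_prod_entries.
apply: eq_bigr => J _.
have -> : map (lshift m) [tuple of j :: J] = lshift m j :: map (lshift m) J by [].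
rewrite partials_cons; apply: (congr1 (fun f => pd _ (partials _ f) x)).
apply/funext => u.
rewrite big_ord_recl !tnth0 -mulrA mulrCA; congr (_ * _).
by congr (_ * _); apply: eq_bigr => a _; rewrite !tnthS.
Qed.

Lemma surface_integral_weighted_partials s (I : s.-tuple 'I_k) H : test_in A H ->
  surface_integral (weighted_partials b I H) = \sum_(J : s.-tuple 'I_k)
    surface_integral (partials (map (lshift m) J)
      (fun u => \prod_(a < s) b u (tnth I a) (tnth J a) * H u)).
Proof.
move=> tH; rewrite weighted_partialsE//.
rewrite (surface_integral_sum (A := A))// => J; apply: test_in_partials.
exact: test_in_prod_entries.
Qed.

End weighted_partials_tuple.

(** * Partitions of unity *)

Section flat_functions.
Context {R : realType}.

(** For j = 0 this is the classical flat function exp(-1/x). The powers of 1/x make the family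
    closed under differentiation, so that smoothness follows by induction over all j. *)
Definition flat (j : nat) (x : R) : R := if 0 < x then x ^- j * expR (- x^-1) else 0.

Lemma flat_ge0 j x : 0 <= flat j x.
Proof.
rewrite /flat; case: ifPn => // x0.
by rewrite mulr_ge0 ?expR_ge0// invr_ge0 exprn_ge0// ltW.
Qed.

Lemma flat_gt0 j x : (0 < flat j x) = (0 < x).
Proof.
rewrite /flat; case: ifPn => [x0|]; last by rewrite ltxx.
by rewrite mulr_gt0 ?expR_gt0// invr_gt0 exprn_gt0.
Qed.

Lemma flat_le0 j x : x <= 0 -> flat j x = 0.
Proof. by rewrite /flat leNgt => /negbTE ->. Qed.

(** The exponential series gives exp(1/x) >= x^-(j+1) / (j+1)!, and one factor x survives. *)
Lemma flat_bound j x : 0 <= x -> flat j x <= j.+1`!%:R * x.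
Proof.
rewrite le_eqVlt => /predU1P[<-|x0]; first by rewrite flat_le0// mulr0.
rewrite /flat x0 expRN ler_pdivrMr ?expR_gt0//.
have xV0 : 0 <= x^-1 by rewrite invr_ge0 ltW.
have F0 : (0 : R) < j.+1`!%:R by rewrite ltr0n fact_gt0.
have := expR_ge1Dxn j xV0 => H.
have {}H : x^-1 ^+ j.+1 / j.+1`!%:R <= expR x^-1 by lra.
rewrite -ler_pdivrMl ?mulr_gt0//; apply: le_trans H.
by rewrite -invfM -mulrA -exprS invfM [X in X <= _]mulrC exprVn.
Qed.

Lemma fct_exprE (f : R -> R) j (y : R) : (f ^+ j) y = f y ^+ j.
Proof. by elim: j => [//|j IH]; rewrite !exprS -[LHS]/(f y * (f ^+ j) y) IH. Qed.

Lemma is_derive_flat j (x : R) :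
  is_derive x 1 (flat j) (- j%:R * flat j.+1 x + flat j.+2 x).
Proof.
have [x0|x0|->] := ltgtP x 0.
- rewrite !flat_le0 ?ltW// mulr0 addr0.
  apply: (@near_eq_is_derive _ _ _ (cst 0)).
  have : \forall y \near x, y < 0.
    by apply: open_nbhs_nbhs; split => //; exact: open_lt.
  by apply: filterS => y y0; rewrite flat_le0// ltW.
- suff D : is_derive x 1 (fun y : R => y^-1 ^+ j * expR (- y^-1))
      (- j%:R * flat j.+1 x + flat j.+2 x).
    apply: near_eq_is_derive D.
    have : \forall y \near x, 0 < y.
      by apply: open_nbhs_nbhs; split => //; exact: open_gt.
    by apply: filterS => y y0; rewrite /flat y0 exprVn.
  have xn0 : x != 0 by rewrite gt_eqF.
  have dV : is_derive x 1 (fun y : R => y^-1) (- x ^- 2).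
    have H := @is_deriveV R id x 1 1 xn0 (is_derive_id x 1).
    by apply: (is_derive_eq H); rewrite [_ *: _]mulr1.
  have d1 := is_deriveX j dV.
  have d2 := is_derive1_comp (is_derive_expR _) (is_deriveN dV).
  have d3 := is_deriveM d1 d2.
  have E : (fun y : R => y^-1 ^+ j * expR (- y^-1)) =
      (fun y : R => y^-1) ^+ j * (expR \o (- (fun y : R => y^-1))).
    by apply/funext => y; rewrite -[RHS]/(((fun y : R => y^-1) ^+ j) y * _) fct_exprE.
  rewrite E; apply: (is_derive_eq d3).
  rewrite fct_exprE /flat x0 /= -[(- (fun y : R => y^-1)) x]/(- x^-1).
  move: (expR _) => z; rewrite /GRing.scale/= opprK -!exprVn.
  case: j {d1 d3 E} => [|j] /=; first by rewrite !expr0; ring.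
  by rewrite !exprS; ring.
rewrite !flat_le0// mulr0 addr0.
suff H : h^-1 *: ((flat j \o shift 0) (h *: 1) - flat j 0) @[h --> (0 : R)^'] --> (0 : R).
  by split; [exact: cvgP H|exact: cvg_lim H].
apply/cvgrPdist_le => e e0.
(* At 0 the difference quotient for h > 0 is [flat j.+1 h]; D is the constant that [flat_bound]
   gives for it. *)
pose D : R := j.+2`!%:R; have D0 : 0 < D by rewrite ltr0n fact_gt0.
near=> h.
have hn0 : h != 0 by near: h; exact: nbhs_dnbhs_neq.
have hd : `|h| < e / D by near: h; apply: dnbhs0_lt; rewrite divr_gt0.
rewrite sub0r normrN /= [h *: 1]mulr1 addr0 (@flat_le0 _ 0)// subr0.
have [h0|h0] := leP h 0; first by rewrite flat_le0// scaler0 normr0 ltW.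
have -> : h^-1 *: flat j h = flat j.+1 h.
  by rewrite /flat h0 [LHS]mulrA -invfM -exprS.
rewrite ger0_norm ?flat_ge0//; apply: (le_trans (flat_bound _ (ltW h0))).
by rewrite mulrC -ler_pdivlMr// (le_trans (ler_norm _))// ltW.
Unshelve. all: by end_near. Qed.

End flat_functions.

Section bump_functions.
Context {R : realType}.

Lemma pd_comp1 n i (g : R -> R) (q : 'rV[R]_n -> R) x :
  differentiable g (q x) -> differentiable q x ->
  pd i (fun y => g (q y)) x = 'D_1 g (q x) * pd i q x.
Proof.
Transparent pd.
move=> dg dq; rewrite /pd (@deriveE _ _ _ (g \o q)); last exact: differentiable_comp.
rewrite diff_comp//= !deriveE//.
have E : 'd q x (delta_mx 0 i) = 'd q x (delta_mx 0 i) *: (1 : R) by rewrite [RHS]mulr1.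
by rewrite {1}E linearZ; exact: mulrC.
Opaque pd.
Qed.

(** The induction on r is for all j at once, because differentiation raises j. *)
Lemma Ck_flat_comp n r (U : set 'rV[R]_n) j q : open U ->
  Ck r U q -> Ck r U (fun x => flat j (q x)).
Proof.
move=> oU; have dflat c (x : R) : differentiable (flat c) x.
  by apply/derivable1_diffP; have [] := is_derive_flat c x.
elim: r j => [|r IH] j Cq.
  move=> x Ux; apply: (@continuous_comp _ _ _ q (flat j)); first exact: Cq.
  exact: differentiable_continuous.
have [dq cq] := Cq; split=> [x Ux|i].
  by apply: (@differentiable_comp _ _ _ _ q (flat j)); first exact: dq.
have C1 : Ck r U (fun x => (- j%:R * flat j.+1 (q x) + flat j.+2 (q x)) * pd i q x).
  apply: (CkM oU _ (cq i)); apply: (CkD oU); last exact: IH (CkW Cq).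
  by apply: (CkM oU); [exact: Ck_cst|exact: IH (CkW Cq)].
apply: (Ck_ext oU) C1 => x Ux; rewrite pd_comp1//; last exact: dq.
by have [_ ->] := is_derive_flat j (q x).
Qed.

Lemma smooth_flat_comp n (U : set 'rV[R]_n) j q : open U ->
  smooth U q -> smooth U (fun x => flat j (q x)).
Proof.
move=> oU /(smoothP _ oU) Cq; apply/(smoothP _ oU) => r; exact: Ck_flat_comp.
Qed.

(** The quotient flat(c - q) / (flat(c - q) + flat(q - c/2)) equals 1 for q < c/2 and 0 for q >= c;
    one of the two arguments is always positive, so the denominator never vanishes. *)
Lemma exists_bump n (U : set 'rV[R]_n) p : open U -> U p ->
  exists f V, [/\ test_in U f, open V, V p & forall x, V x -> f x = 1].
Proof.
move=> oU Up.
have /nbhs_ballP[r /= r0 rU] := open_near oU Up.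
(* The squared Euclidean distance to p is a polynomial, unlike the sup norm that defines balls
   here. *)
pose q (x : 'rV[R]_n) := \sum_i (x 0 i - p 0 i) * (x 0 i - p 0 i).
have sq : smooth setT q.
  have oT := @openT 'rV[R]_n.
  apply: (smooth_sum oT) => i; have sc : smooth setT (fun x : 'rV[R]_n => x 0 i - p 0 i).
    by apply: (smoothD oT); [exact: smooth_coord|exact: smooth_cst].
  exact: (smoothM oT).
have q_ge (x : 'rV[R]_n) i : (x 0 i - p 0 i) ^+ 2 <= q x.
  rewrite /q (bigD1 i)//= -expr2 lerDl sumr_ge0// => j _.
  by rewrite -expr2 sqr_ge0.
(* Since q dominates the square of each coordinate difference, q <= c confines x to sup-distance
   r/2, strictly inside the ball of radius r. *)
pose c := (r / 2) ^+ 2; have c0 : 0 < c by rewrite exprn_gt0// divr_gt0.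
have qc (x : 'rV[R]_n) : q x <= c -> `|x - p| <= r / 2.
  move=> qxc; apply: norm_le_entries => [|i]; first by rewrite divr_ge0// ltW.
  rewrite !mxE -(@ler_pXn2r _ 2)// ?nnegrE ?divr_ge0 ?(ltW r0)//.
  by rewrite real_normK ?num_real//; exact: le_trans (q_ge x i) qxc.
have ltc : c / 2 < c by lra.
pose D x := flat 0 (c - q x) + flat 0 (q x - c / 2).
have D0 x : D x != 0.
  rewrite gt_eqF// /D; have [qx|qx] := ltP (q x) c.
    by apply: ltr_wpDr; rewrite ?flat_ge0// flat_gt0 subr_gt0.
  by apply: ltr_wpDl; rewrite ?flat_ge0// flat_gt0 subr_gt0; apply: lt_le_trans qx.
have oT := @openT 'rV[R]_n.
have s1 : smooth setT (fun x => flat 0 (c - q x)).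
  apply: smooth_flat_comp => //.
  by apply: (smoothB oT _ sq); exact: smooth_cst.
have s2 : smooth setT (fun x => flat 0 (q x - c / 2)).
  apply: smooth_flat_comp => //.
  by apply: (smoothB oT sq); exact: smooth_cst.
have cq : continuous q by move=> x; exact: (smooth_continuous sq).
exists (fun x => flat 0 (c - q x) * (D x)^-1), [set x | q x < c / 2]; split.
- split.
    apply: (smoothM oT s1); apply: (smoothV oT) => //.
    exact: (smoothD oT).
  exists [set x | q x <= c]; split.
  + apply: bounded_closed_compact.
      exists (`|p| + r / 2); split=> [|M MM x /= /qc xp]; first exact: num_real.
      rewrite -(subrK p x); apply: (le_trans (ler_normD _ _)).
      by apply: le_trans (ltW MM); rewrite addrC lerD2l.
    apply: (@closed_comp _ _ q [set r : R | r <= c]); last exact: closed_le.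
    by move=> x _; exact: cq.
  + move=> x /= /qc xp; apply: rU; rewrite -ball_normE /= distrC.
    by apply: (le_lt_trans xp); lra.
  + move=> x /= /negP; rewrite -ltNge => qx.
    by rewrite flat_le0 ?mul0r// subr_le0 ltW.
- apply: (@open_comp _ _ q [set r : R | r < c / 2]); last exact: open_lt.
  by move=> x _; exact: cq.
- rewrite /= /q big1 ?divr_gt0// => i _; by rewrite subrr mulr0.
- move=> x /= qx; rewrite /D (@flat_le0 _ _ (q x - c / 2)) ?subr_le0 1?ltW//.
  by rewrite addr0 mulfV// gt_eqF// flat_gt0 subr_gt0 (lt_trans qx).
Qed.

(** Finitely many bumps, each equal to 1 on one member of a cover of K, are combined one at a time
    by f, (1 - f) rho_1, (1 - f) rho_2, ..., without division. [J] is an arbitrary type so that a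
    piece can carry a pair of charts. *)
Lemma partition_of_unity n (J : Type) (D : J -> set 'rV[R]_n) (K : set 'rV[R]_n) :
  compact K -> (forall p, K p -> exists2 j, open (D j) & D j p) ->
  exists N (c : 'I_N -> J) (rho : 'I_N -> 'rV[R]_n -> R) V,
    [/\ forall a, open (D (c a)) /\ test_in (D (c a)) (rho a), open V, K `<=` V &
        forall x, V x -> \sum_(a < N) rho a x = 1].
Proof.
move=> cK KD.
(* The option and the empty set serve as default off K, where no bump is given, and make the choice
   a total function of p. *)
have KB p : exists q : option (J * ('rV[R]_n -> R)) * set 'rV[R]_n, K p ->
   exists j f, [/\ q.1 = Some (j, f), open (D j) /\ test_in (D j) f, open q.2, q.2 p &
     forall x, q.2 x -> f x = 1].
  case: (pselect (K p)) => [Kp|nKp]; last by exists (None, set0).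
  have [j oD Dp] := KD p Kp; have [f [V [tf oV Vp V1]]] := exists_bump oD Dp.
  by exists (Some (j, f), V) => _; exists j, f; split.
pose F p := sval (cid (KB p)).
have FP p : K p -> exists j f, [/\ (F p).1 = Some (j, f), open (D j) /\ test_in (D j) f,
    open (F p).2, (F p).2 p & forall x, (F p).2 x -> f x = 1].
  by rewrite /F; case: cid.
have [S SK cov] : finite_subset_cover K (fun p => (F p).2) K.
  move: cK; rewrite compact_cover; apply.
    by move=> p /FP[j [f []]].
  by move=> p Kp; exists p => //; have [j [f []]] := FP p Kp.
have [N [c [rho [tr sum1]]]] : exists N (c : 'I_N -> J) (rho : 'I_N -> 'rV[R]_n -> R),
    (forall a, open (D (c a)) /\ test_in (D (c a)) (rho a)) /\
    forall x, (exists2 p, p \in finmap.enum_fset S & (F p).2 x) -> \sum_(a < N) rho a x = 1.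
  have : forall p, p \in finmap.enum_fset S -> K p by move=> p /SK; rewrite inE.
  elim: (finmap.enum_fset S) => [|p s IH] sK.
    have c0 : 'I_0 -> J by case.
    by exists 0%N, c0, (fun _ _ => 0); split=> [[]//|x []].
  have [j [f [_ Df _ _ f1]]] := FP p (sK p (mem_head _ _)).
  have [|N [c [rho [tr sum1]]]] := IH.
    by move=> p' p's; apply: sK; rewrite inE p's orbT.
  (* The new sum is f + (1 - f) times the old one, hence 1 wherever f or the old sum is 1. *)
  exists N.+1, (fun a => if unlift ord0 a is Some a' then c a' else j),
    (fun a x => if unlift ord0 a is Some a' then (1 - f x) * rho a' x else f x).
  split=> [a|x].
    case: (unliftP ord0 a) => [a' _|_] //; have [oD tra] := tr a'; split=> //.
    apply: (test_inM oD _ tra); apply: (smoothB oD); first exact: smooth_cst.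
    exact: test_in_smooth Df.2.
  move=> [p']; rewrite inE => /orP[/eqP ->|p's] Fx.
    rewrite big_ord_recl unlift_none f1// big1 ?addr0// => a _.
    by rewrite liftK subrr mul0r.
  rewrite big_ord_recl unlift_none.
  under eq_bigr do rewrite liftK.
  by rewrite -mulr_sumr sum1 ?mulr1 ?subrKC//; exists p'.
exists N, c, rho, (\bigcup_(p in [set p | p \in finmap.enum_fset S]) (F p).2); split=> //.
- by apply: bigcup_open => p /= pS; have := SK p pS; rewrite inE => /FP[j [f []]].
Qed.

End bump_functions.

(** * Adapted charts *)

Section charts.
Context {R : realType} {k m : nat}.
Local Notation pt := 'rV[R]_(k + m).

Lemma open_preimage n p (U : set 'rV[R]_n) (V : set 'rV[R]_p) f :
  open U -> open V -> smoothmx U f -> open (U `&` f @^-1` V).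
Proof.
move=> oU oV sf; rewrite openE => x [Ux Vfx]; rewrite /interior.
have nV : \forall y \near x, V (f y).
  exact: (smoothmx_continuous sf Ux) (open_near oV Vfx).
exact: filterI (open_near oU Ux) nV.
Qed.

Lemma smoothmx_row_mx n p q (U : set 'rV[R]_n) (f : _ -> 'rV[R]_p) (g : _ -> 'rV[R]_q) :
  smoothmx U f -> smoothmx U g -> smoothmx U (fun x => row_mx (f x) (g x)).
Proof.
move=> sf sg; apply/smoothmxP => i j.
have -> : (fun x => row_mx (f x) (g x) i j) = fun x =>
  match fintype.split j with inl a => f x i a | inr a => g x i a end.
  by apply/funext => x; rewrite mxE.
by case: (fintype.split j) => a; exact: smooth_entry.
Qed.

Lemma smoothmx_rsubmx n p q (U : set 'rV[R]_n) (f : _ -> 'rV[R]_(p + q)) :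
  smoothmx U f -> smoothmx U (fun x => rsubmx (f x)).
Proof.
move=> sf; apply/smoothmxP => i j.
have -> : (fun x => rsubmx (f x) i j) = fun x => f x i (rshift p j).
  by apply/funext => x; rewrite mxE.
exact: smooth_entry.
Qed.

Lemma smoothmx_lsubmx n p q (U : set 'rV[R]_n) (f : _ -> 'rV[R]_(p + q)) :
  smoothmx U f -> smoothmx U (fun x => lsubmx (f x)).
Proof.
move=> sf; apply/smoothmxP => i j.
have -> : (fun x => lsubmx (f x) i j) = fun x => f x i (lshift q j).
  by apply/funext => x; rewrite mxE.
exact: smooth_entry.
Qed.

Lemma smoothmx_cst n p q (U : set 'rV[R]_n) (M : 'M[R]_(p, q)) :
  open U -> smoothmx U (fun=> M).
Proof. by move=> oU; apply/smoothmxP => i j; exact: smooth_cst. Qed.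

Lemma smoothmx_id n (U : set 'rV[R]_n) : open U -> smoothmx U id.
Proof. by move=> oU; apply/smoothmxP => i j; rewrite ord1; exact: smooth_coord. Qed.

Lemma smoothmx_comp n p q r (U : set 'rV[R]_n) (V : set 'rV[R]_p)
    (f : _ -> 'M[R]_(q, r)) (g : 'rV[R]_n -> 'rV[R]_p) : open U -> open V ->
  (forall x, U x -> V (g x)) -> smoothmx V f -> smoothmx U g ->
  smoothmx U (fun x => f (g x)).
Proof.
move=> oU oV UV sf sg; apply/smoothmxP => i j.
exact: (smooth_comp oU oV UV (smooth_entry i j sf) sg).
Qed.

Section build.
Variables (P : pt -> 'rV[R]_k) (D Z W : set pt) (f g : pt -> pt).
Hypotheses (oZ : open Z) (oW : open W) (sf : smoothmx D f) (sg : smoothmx Z g)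
  (WD : W `<=` D) (WZ : forall x, W x -> Z (f x))
  (gK : forall x, W x -> g (f x) = x) (fK : forall z, Z z -> D (g z) -> f (g z) = z)
  (fP : forall x, D x -> lsubmx (f x) = P x).

(** Since g inverts f explicitly, the range of the chart is a preimage under the continuous map g,
    and therefore open. *)
Let imageE : f @` W = Z `&` g @^-1` W.
Proof.
apply/seteqP; split=> [_ [x Wx <-]|z [Zz Wz]].
  by split; [exact: WZ|rewrite /= gK].
by exists (g z) => //; apply: fK => //; exact: WD.
Qed.

Let image_open : open (f @` W).
Proof. by rewrite imageE; exact: open_preimage. Qed.

Let sfW : smooth_mx_on W f.
Proof. by have [] := smoothmxS WD sf. Qed.

Let sgW : smooth_mx_on (f @` W) g.
Proof.
have ZW : f @` W `<=` Z by move=> _ [x Wx <-]; exact: WZ.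
by have [] := smoothmxS ZW sg.
Qed.

Let fPW x : W x -> lsubmx (f x) = P x.
Proof. by move=> /WD; exact: fP. Qed.

Definition build_chart : adapted_chart P :=
  AdaptedChart oW image_open sfW sgW gK fPW.

End build.

Section chart_facts.
Variables (P : pt -> 'rV[R]_k) (c : adapted_chart P).

Definition chart_cod : set pt := chart_map c @` chart_dom c.

Lemma smooth_chart_map : smoothmx (chart_dom c) (chart_map c).
Proof. by split; exact: chart_map_smooth. Qed.

Lemma smooth_chart_inv : smoothmx chart_cod (chart_inv c).
Proof. by split; exact: chart_inv_smooth. Qed.

Lemma open_chart_cod : open chart_cod.
Proof. exact: chart_cod_open. Qed.

Lemma chart_map_cod x : chart_dom c x -> chart_cod (chart_map c x).
Proof. by move=> Dx; exists x. Qed.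

Lemma chart_inv_dom z : chart_cod z -> chart_dom c (chart_inv c z).
Proof. by move=> [x Dx <-]; rewrite chart_mapK. Qed.

Lemma chart_invK z : chart_cod z -> chart_map c (chart_inv c z) = z.
Proof. by move=> [x Dx <-]; rewrite chart_mapK. Qed.

Lemma chart_map_surface x : chart_dom c x -> P x = 0 ->
  chart_map c x = row_mx 0 (rsubmx (chart_map c x)).
Proof. by move=> Dx Px; rewrite -[LHS]hsubmxK chart_adapted// Px. Qed.

Lemma chart_inv_surface y : chart_cod (row_mx 0 y) -> P (chart_inv c (row_mx 0 y)) = 0.
Proof.
by move=> Cy; rewrite -(chart_adapted (chart_inv_dom Cy)) chart_invK// row_mxKl.
Qed.

Lemma in_chartE phi : in_chart c phi = pullback chart_cod (chart_inv c) phi.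
Proof.
rewrite /in_chart /pullback; apply/funext => u; rewrite !patchE.
case: ifPn => // /set_mem Cu.
by rewrite (jacobianE_mx open_chart_cod smooth_chart_inv).
Qed.

Lemma test_in_in_chart phi : test_in (chart_dom c) phi -> test_in chart_cod (in_chart c phi).
Proof.
rewrite in_chartE; apply: test_in_pullback.
- exact: chart_dom_open.
- exact: open_chart_cod.
- exact: smooth_chart_inv.
- exact: smooth_chart_map.
- exact: chart_inv_dom.
- exact: chart_map_cod.
- exact: chart_invK.
Qed.

End chart_facts.

Section sign.
Variables (P : pt -> 'rV[R]_k) (S : set pt) (o : orientation m S).
Hypothesis SP : S = [set x | P x = 0].

Section frame.
Variable c : adapted_chart P.

Definition chart_frame (u : pt) : 'M[R]_(m, k + m) := dsubmx ('J (chart_inv c) u).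

Lemma chart_frameE u i j : chart_cod c u ->
  chart_frame u i j = pd (rshift k i) (fun w => chart_inv c w 0 j) u.
Proof.
move=> Cu; rewrite mxE (jacobianE_mx (@open_chart_cod P c) (smooth_chart_inv c) Cu).
by rewrite mxE.
Qed.

(** The frame is free because it consists of rows of an invertible Jacobian matrix. Its rows are the
    velocities of the tangential coordinate lines, which stay in S. *)
Lemma chart_frame_tangent y : chart_cod c (row_mx 0 y) ->
  tangent_frame S (chart_inv c (row_mx 0 y)) (chart_frame (row_mx 0 y)).
Proof.
move=> Cy; split.
  have JV := jacobi_mxV (@chart_dom_open _ _ _ _ c) (@open_chart_cod P c) (smooth_chart_inv c)
    (smooth_chart_map c) (@chart_inv_dom _ c) (@chart_invK _ c) Cy.
  (* The last m rows of the Jacobian matrix of the inverse, times the last m columns of that of the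
     chart, give the lower right block of the identity. *)
  apply/row_freeP; exists (rsubmx (jacobi_mx (chart_map c) (chart_inv c (row_mx 0 y)))).
  rewrite /chart_frame (jacobianE_mx (@open_chart_cod P c) (smooth_chart_inv c) Cy).
  rewrite mul_dsub_mx mulmx_rsub JV.
  by apply/matrixP => i j; rewrite !mxE (inj_eq (@rshift_inj _ _)).
move=> i; pose u : pt := row_mx 0 y; pose v : pt := delta_mx 0 (rshift k i).
have dinv j : is_derive (0 : R) (1 : R) (fun t => chart_inv c (t *: v + u) 0 j)
    (pd (rshift k i) (fun w => chart_inv c w 0 j) u).
  have E : 0 *: v + u = u by rewrite scale0r add0r.
  have := @is_derive_line R _ (fun w => chart_inv c w 0 j) u v 0.
  rewrite E; apply; apply: diff_derivable.
  apply: (smooth_differentiable (@open_chart_cod P c) _ Cy).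
  exact: smooth_entry (smooth_chart_inv c).
have dinv_mx : derivable (fun t : R => chart_inv c (t *: v + u)) 0 1.
  by apply/derivable_mxP => a j; rewrite ord1; have [] := dinv j.
exists (fun t : R => chart_inv c (t *: v + u)); split=> //.
- by rewrite scale0r add0r.
- have n0 : \forall z \near (0 *: v + u), chart_cod c z.
    by rewrite scale0r add0r; exact: open_near (@open_chart_cod P c) Cy.
  have cl : {for 0, continuous (fun t : R => t *: v + u)}.
    move=> /=; apply: cvgD; last exact: cvg_cst.
    by apply: cvgZr_tmp; exact: cvg_id.
  have H : \forall t \near (0 : R), chart_cod c (t *: v + u) by exact: (cl _ n0).
  near=> t; have Ct : chart_cod c (t *: v + u) by near: t.
  move: Ct; rewrite /u row_mx0_shift => Ct.
  by rewrite SP /= chart_inv_surface.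
- rewrite derive_mx//; apply/rowP => j.
  rewrite mxE [RHS]mxE chart_frameE//.
  by have [_ ->] := dinv j.
Unshelve. all: by end_near. Qed.

Lemma chart_frame_continuous x : chart_dom c x ->
  {for x, continuous (fun z => chart_frame (chart_map c z))}.
Proof.
move=> Dx; apply: continuous_mx => i j.
have s : smooth (chart_dom c)
    (fun z => pd (rshift k i) (fun w => chart_inv c w 0 j) (chart_map c z)).
  apply: (smooth_comp (@chart_dom_open _ _ _ _ c) (@open_chart_cod P c) (@chart_map_cod P c)).
    by apply: smooth_pd; exact: smooth_entry (smooth_chart_inv c).
  exact: smooth_chart_map.
apply: near_continuous (smooth_continuous s Dx).
apply: filterS (open_near (@chart_dom_open _ _ _ _ c) Dx) => z Dz.
by rewrite chart_frameE//; exact: chart_map_cod.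
Qed.

(** The sign of the coordinate frame is continuous along S with values 1 and -1, so two values at
    distance less than 1 are equal. *)
Lemma chart_sign_locally_constant p : chart_dom c p -> S p ->
  exists O : set pt, [/\ open O, O p & forall x, O x -> S x -> chart_dom c x ->
    o x (chart_frame (chart_map c x)) = o p (chart_frame (chart_map c p))].
Proof.
move=> Dp Sp; pose f x := o x (chart_frame (chart_map c x)).
have tf x : (S `&` chart_dom c) x -> tangent_frame S x (chart_frame (chart_map c x)).
  move=> [Sx Dx]; have Px : P x = 0 by move: Sx; rewrite SP.
  have := @chart_frame_tangent (rsubmx (chart_map c x)).
  rewrite -(chart_map_surface Dx Px) chart_mapK//; apply.
  exact: chart_map_cod.
have pm x : S x -> chart_dom c x -> f x = 1 \/ f x = -1.
  by move=> Sx Dx; apply: frame_sign_pm1 => //; exact: tf.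
have cf : {within S `&` chart_dom c, continuous f}.
  apply: (@frame_sign_continuous _ _ _ _ o (chart_dom c)
    (fun z => chart_frame (chart_map c z)) (@chart_dom_open _ _ _ _ c) _ tf).
  by apply: continuous_in_subspaceT => x /set_mem[_ Dx]; exact: chart_frame_continuous.
have /subspace_continuousP/(_ p (conj Sp Dp))/cvgrPdist_lt/(_ 1 ltr01) := cf.
rewrite near_withinE => H.
exists (interior [set x | (S `&` chart_dom c) x -> `|f p - f x| < 1]); split.
- exact: open_interior.
- exact: H.
- move=> x /interior_subset/= Hx Sx Dx; have {Hx} := Hx (conj Sx Dx).
  rewrite -/(f x) -/(f p).
  have [->|->] := pm p Sp Dp; have [->|->] := pm x Sx Dx => //.
    by rewrite opprK ger0_norm//; lra.
  by rewrite -opprD normrN ger0_norm//; lra.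
Qed.

(** A constant sign leaves the integral; where the chart has no point, the test function is 0 and
    the value of o is irrelevant. *)
Lemma delta_in_chart_sign (sigma : R) (e : seq 'I_k) phi :
  (forall x, chart_dom c x -> S x -> o x (chart_frame (chart_map c x)) = sigma) ->
  test_in (chart_dom c) phi ->
  delta_in_chart o c e phi =
  (-1) ^+ size e * (sigma * surface_integral (partials (map (lshift m) e) (in_chart c phi))).
Proof.
move=> sign tphi; have tf := test_in_partials (map (lshift m) e) (test_in_in_chart tphi).
rewrite /delta_in_chart -(surface_integralZ _ tf); congr (_ * integral_rV _).
apply/funext => y /=; case: (pselect (chart_cod c (row_mx 0 y))) => Cy; last first.
  by rewrite (test_in_outside tf Cy) !mulr0.
congr (_ * _); rewrite -(sign _ (chart_inv_dom Cy)) ?chart_invK//.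
by rewrite SP /= chart_inv_surface.
Qed.

End frame.
End sign.
End charts.

Lemma pullback_comp (R : realType) n (A B : set 'rV[R]_n) (f psi g : 'rV[R]_n -> 'rV[R]_n)
    (phi : 'rV[R]_n -> R) : open A -> open B -> smoothmx A f -> smoothmx B psi ->
  (forall v, B v -> A (psi v)) -> (forall v, B v -> g v = f (psi v)) ->
  pullback B g phi = pullback B psi (pullback A f phi).
Proof.
move=> oA oB sf spsi psiA gE; apply/funext => v.
case: (pselect (B v)) => Bv; last by rewrite !pullback_out.
rewrite !pullbackE//; last exact: psiA.
rewrite gE// -mulrA [_ * \det (jacobi_mx psi v)]mulrC -det_mulmx.
apply: (congr1 (fun M => _ * \det M)); apply/matrixP => i c; rewrite !mxE.
rewrite (pd_ext i oB (g := fun w => f (psi w) 0 c) _ Bv); last by move=> w Bw; rewrite gE.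
rewrite (pd_smooth_comp oA oB spsi psiA i (smooth_entry 0 c sf) Bv).
by apply: eq_bigr => j _; rewrite !mxE mulrC.
Qed.

(** * Matched charts and the local transformation law *)

Section matched_charts.
Context {R : realType} {k m : nat}.
Local Notation pt := 'rV[R]_(k + m).
Variables (P Q : pt -> 'rV[R]_k) (alpha beta : pt -> 'M[R]_k) (S : set pt)
  (o : orientation m S).
Hypotheses (sQ : smoothmx setT Q) (salpha : smoothmx setT alpha) (sbeta : smoothmx setT beta)
  (SP : S = [set x | P x = 0]) (SQ : S = [set x | Q x = 0])
  (QE : forall x, Q x = P x *m alpha x) (PE : forall x, P x = Q x *m beta x)
  (ba : forall x, beta x *m alpha x = 1%:M).

(** On S the normal coordinates are 0 in both charts, so the second condition equates the tangential
    ones; off S nothing is imposed. The constant sign [sigma] lets the orientation leave the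
    integrals. *)
Definition matched (c : adapted_chart P) (d : adapted_chart Q) (sigma : R) :=
  [/\ chart_dom d = chart_dom c,
      forall x, chart_dom c x -> S x -> chart_map d x = chart_map c x &
      forall x, chart_dom c x -> S x -> o x (chart_frame c (chart_map c x)) = sigma].

Let SP0 x : S x -> P x = 0. Proof. by rewrite SP. Qed.
Let SQ0 x : S x -> Q x = 0. Proof. by rewrite SQ. Qed.

(* The chart of Q is (Q_1, ..., Q_k, y), where the value of y at x is read off
   in the chart of P at the point of S having the same tangential coordinates as
   x in a given chart of Q.  Its inverse is explicit, so that no inverse function
   theorem is needed. *)
Lemma exists_matched_charts p : correct_grid S P -> correct_grid S Q -> S p ->
  exists c d sigma, matched c d sigma /\ chart_dom c p.
Proof.
move=> gP gQ Sp; have [c0 c0p] := gP p Sp; have [d0 d0p] := gQ p Sp.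
have [V [oV Vp signV]] := chart_sign_locally_constant o SP c0p Sp.
move: signV; set sigma := o p _ => signV.
pose U := chart_dom c0; pose C := chart_map c0; pose f := chart_inv c0; pose A0 := chart_cod c0.
pose U' := chart_dom d0; pose E := chart_map d0; pose h := chart_inv d0; pose B0 := chart_cod d0.
have oU : open U := @chart_dom_open _ _ _ _ c0.
have oU' : open U' := @chart_dom_open _ _ _ _ d0.
have oA0 : open A0 := @open_chart_cod _ _ _ _ c0.
have oB0 : open B0 := @open_chart_cod _ _ _ _ d0.
have sC : smoothmx U C := smooth_chart_map c0.
have sE : smoothmx U' E := smooth_chart_map d0.
have sf : smoothmx A0 f := smooth_chart_inv c0.
have sh : smoothmx B0 h := smooth_chart_inv d0.
(* Setting the normal coordinates to 0 moves a point to S along its tangential coordinates, as long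
   as the result stays in the range of the chart. *)
pose T : pt -> pt := fun z => row_mx 0 (rsubmx z).
have sT (O : set pt) : open O -> smoothmx O T.
  move=> oO; apply: smoothmx_row_mx; first exact: smoothmx_cst.
  by apply: smoothmx_rsubmx; exact: smoothmx_id.
have hE x : U' x -> h (E x) = x by exact: chart_mapK.
have fC x : U x -> f (C x) = x by exact: chart_mapK.
have Eh z : B0 z -> E (h z) = z by exact: chart_invK.
have Cf z : A0 z -> C (f z) = z by exact: chart_invK.
have U'h z : B0 z -> U' (h z) by exact: chart_inv_dom.
have Uf z : A0 z -> U (f z) by exact: chart_inv_dom.
have BE x : U' x -> B0 (E x) by exact: chart_map_cod.
have AC x : U x -> A0 (C x) by exact: chart_map_cod.
have EQ x : U' x -> lsubmx (E x) = Q x by exact: chart_adapted.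
have CP x : U x -> lsubmx (C x) = P x by exact: chart_adapted.
have TE x : U' x -> S x -> T (E x) = E x.
  by move=> U'x /SQ0 Qx; rewrite -[RHS]hsubmxK EQ// Qx.
have TC x : U x -> S x -> T (C x) = C x.
  by move=> Ux /SP0 Px; rewrite -[RHS]hsubmxK CP// Px.
have sign x : V x -> S x -> U x -> o x (dsubmx ('J f (C x))) = sigma by exact: signV.
move: c0p d0p; rewrite -/U -/U' => c0p d0p.
clearbody U C f A0 U' E h B0.
(* [O1] and [D] make the projection to S legitimate: projected coordinates must stay in the range of
   [d0], and the resulting point of S in the domain of [c0]. *)
pose O1 := B0 `&` h @^-1` U.
have oO1 : open O1 by exact: open_preimage.
pose D := U' `&` (fun x => T (E x)) @^-1` O1.
have sTE : smoothmx U' (fun x => T (E x)).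
  apply: smoothmx_row_mx; first exact: smoothmx_cst.
  exact: smoothmx_rsubmx.
have oD : open D by exact: open_preimage.
pose F : pt -> pt := fun x => row_mx (Q x) (rsubmx (C (h (T (E x))))).
have DU' : D `<=` U' by move=> x [].
have sF : smoothmx D F.
  apply: smoothmx_row_mx; first exact: smoothmxS sQ.
  apply: smoothmx_rsubmx.
  apply: (smoothmx_comp (V := O1) (f := fun z => C (h z)) oD oO1) => [x []//||].
    by apply: (smoothmx_comp oO1 oU) => [x []//|//|]; apply: smoothmxS sh => x [].
  exact: smoothmxS sTE.
pose A1 := A0 `&` f @^-1` U'.
have oA1 : open A1 by exact: open_preimage.
pose A2 := setT `&` T @^-1` A1.
have oA2 : open A2 by apply: open_preimage; [exact: openT|exact: oA1|exact: (sT _ openT)].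
(* [G0] converts new coordinates back to those of [d0]: the normal part is kept, and the tangential
   part is read off in [d0] at the point of S whose [c0] coordinates are [T z]. *)
pose G0 : pt -> pt := fun z => row_mx (lsubmx z) (rsubmx (E (f (T z)))).
have sG0 : smoothmx A2 G0.
  apply: smoothmx_row_mx; first by apply: smoothmx_lsubmx; exact: smoothmx_id.
  apply: smoothmx_rsubmx.
  apply: (smoothmx_comp (V := A1) (f := fun z => E (f z)) oA2 oA1) => [x []//||].
    by apply: (smoothmx_comp oA1 oU') => [x []//|//|]; apply: smoothmxS sf => x [].
  exact: sT.
pose Z := A2 `&` G0 @^-1` B0.
have oZ : open Z by exact: open_preimage.
pose G z := h (G0 z).
have sG : smoothmx Z G.
  apply: (smoothmx_comp oZ oB0) => [x []//|//|]; apply: smoothmxS sG0 => x [//].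
have ZF x : D x -> Z (F x) -> G (F x) = x.
  move=> [U'x [B0x Ux]] [[_ [A0z U'z]] B0z].
  (* The projected point [h (T (E x))] lies on S because its Q coordinates are 0; so its [C]
     coordinates have zero normal part, and [T] recovers them from [F x]. *)
  have U's := U'h _ B0x; have Es := Eh _ B0x.
  have Ss : S (h (T (E x))) by rewrite SQ /= -(EQ _ U's) Es row_mxKl.
  have fs : f (T (F x)) = h (T (E x)).
    by rewrite /T row_mxKr -/(T _) TC// fC.
  by rewrite /G /G0 fs Es row_mxKr row_mxKl -(EQ _ U'x) hsubmxK hE.
have FZ z : Z z -> D (G z) -> F (G z) = z.
  move=> [[_ [A0z U'z]] B0z] [U'x [B0x Ux]].
  have Ut := Uf _ A0z; have Ct := Cf _ A0z.
  have St : S (f (T z)) by rewrite SP /= -(CP _ Ut) Ct row_mxKl.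
  have EG : E (G z) = G0 z by exact: Eh.
  have Et : T (E (G z)) = E (f (T z)) by rewrite EG /T row_mxKr -/(T _) TE.
  by rewrite /F -(EQ _ U'x) Et hE// Ct EG row_mxKl row_mxKr hsubmxK.
have FP x : D x -> lsubmx (F x) = Q x by rewrite row_mxKl.
have FC x : S x -> U x -> U' x -> F x = C x.
  by move=> Sx Ux U'x; rewrite /F TE// hE// SQ0// -[RHS]TC.
(* The common domain of both charts: [V] keeps the orientation sign constant, and the preimage of
   [Z] under F is where the explicit inverse applies. *)
pose W := (U `&` V) `&` (D `&` F @^-1` Z).
have oW : open W.
  by apply: openI; [exact: openI|exact: open_preimage].
have Dp : D p.
  by split=> //=; rewrite /O1 TE//; split; [exact: BE|rewrite /= hE].
have Wp : W p.
  split=> //; split=> //=; rewrite FC//; split.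
    by split=> //=; rewrite TC//; split; [exact: AC|rewrite /= fC].
  by rewrite /= /G0 TC// fC// CP// SP0// -(SQ0 Sp) -(EQ _ d0p) hsubmxK; exact: BE.
have WU : W `<=` U by move=> x [[]].
have WD : W `<=` D by move=> x [_ []].
have WZ x : W x -> Z (F x) by move=> [_ []].
have cK x : W x -> f (C x) = x by move=> /WU; exact: fC.
have CA x : W x -> A0 (C x) by move=> /WU; exact: AC.
have fK z : A0 z -> U (f z) -> C (f z) = z by move=> /Cf.
have FK x : W x -> G (F x) = x by move=> Wx; apply: ZF; [exact: WD|exact: WZ].
pose c := build_chart oA0 oW sC sf WU CA cK fK CP.
pose d := build_chart oZ oW sF sG WD WZ FK FZ FP.
exists c, d, sigma; split; last exact: Wp.
split; first exact: (erefl W).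
  move=> x; change (W x -> S x -> F x = C x) => -[[Ux _] [[U'x _] _]] Sx; exact: FC.
move=> x; change (W x -> S x -> o x (dsubmx ('J f (C x))) = sigma).
by move=> [[Ux Vx] _] Sx; exact: (sign x Vx Sx Ux).
Qed.

Section delta_matched.
Variables (c : adapted_chart P) (d : adapted_chart Q) (sigma : R).
Hypothesis cd : matched c d sigma.
Let A := chart_cod c.
Let B := chart_cod d.
Let psi v := chart_map c (chart_inv d v).
Let chi u := chart_map d (chart_inv c u).
Let a u := alpha (chart_inv c u).
Let b u := beta (chart_inv c u).

Let domE : chart_dom d = chart_dom c. Proof. by case: cd. Qed.

Let oA : open A. Proof. exact: open_chart_cod. Qed.
Let oB : open B. Proof. exact: open_chart_cod. Qed.

Let dom_c v : B v -> chart_dom c (chart_inv d v).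
Proof. by rewrite -domE; exact: chart_inv_dom. Qed.

Let dom_d u : A u -> chart_dom d (chart_inv c u).
Proof. by rewrite domE; exact: chart_inv_dom. Qed.

Let spsi : smoothmx B psi.
Proof.
apply: (smoothmx_comp oB (@chart_dom_open _ _ _ _ c) dom_c).
  exact: smooth_chart_map.
exact: smooth_chart_inv.
Qed.

Let schi : smoothmx A chi.
Proof.
apply: (smoothmx_comp oA (@chart_dom_open _ _ _ _ d) dom_d).
  exact: smooth_chart_map.
exact: smooth_chart_inv.
Qed.

Let psiA v : B v -> A (psi v).
Proof. by move=> Bv; apply: chart_map_cod; exact: dom_c. Qed.

Let chiB u : A u -> B (chi u).
Proof. by move=> Au; apply: chart_map_cod; exact: dom_d. Qed.

Let inv_psi v : B v -> chart_inv c (psi v) = chart_inv d v.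
Proof. by move=> Bv; rewrite /psi chart_mapK//; exact: dom_c. Qed.

Let psiK v : B v -> chi (psi v) = v.
Proof. by move=> Bv; rewrite /chi inv_psi// chart_invK. Qed.

Let chiK u : A u -> psi (chi u) = u.
Proof. by move=> Au; rewrite /psi /chi chart_mapK ?chart_invK//; exact: dom_d. Qed.

Let sa : smoothmx A a.
Proof.
by apply: (smoothmx_comp oA openT _ salpha) => //; exact: smooth_chart_inv.
Qed.

Let sb : smoothmx A b.
Proof.
by apply: (smoothmx_comp oA openT _ sbeta) => //; exact: smooth_chart_inv.
Qed.

Let ba1 u : A u -> b u *m a u = 1%:M.
Proof. by move=> _; exact: ba. Qed.

Let lshift_entry n1 (z : 'rV[R]_(k + n1)) j : z 0 (lshift n1 j) = lsubmx z 0 j.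
Proof. by rewrite mxE. Qed.

Let psi_normal v : B v -> forall j,
  psi v 0 (lshift m j) = \sum_i v 0 (lshift m i) * b (psi v) i j.
Proof.
move=> Bv j; rewrite lshift_entry /psi chart_adapted; last exact: dom_c.
rewrite PE mxE; apply: eq_bigr => i _.
have Qv : Q (chart_inv d v) = lsubmx v.
  by rewrite -(chart_adapted (chart_inv_dom Bv)) chart_invK.
by rewrite -/(psi v) /b inv_psi// lshift_entry Qv.
Qed.

Let chi_normal u : A u -> forall j,
  chi u 0 (lshift m j) = \sum_i u 0 (lshift m i) * a u i j.
Proof.
move=> Au j; rewrite lshift_entry /chi chart_adapted; last exact: dom_d.
rewrite QE mxE; apply: eq_bigr => i _.
have Pu : P (chart_inv c u) = lsubmx u.
  by rewrite -(chart_adapted (chart_inv_dom Au)) chart_invK.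
by rewrite lshift_entry Pu.
Qed.

(** The point of S with [c] coordinates (0, y) has the same [d] coordinates by matching, so both
    charts parametrize S by the same y. *)
Let A_B y : A (row_mx 0 y) -> B (row_mx 0 y) /\
  chart_inv d (row_mx 0 y) = chart_inv c (row_mx 0 y).
Proof.
move=> Ay; have Dx := chart_inv_dom Ay; set x := chart_inv c _ in Dx *.
have Sx : S x by rewrite SP /= chart_inv_surface.
have E : row_mx 0 y = chart_map d x.
  by case: cd => _ -> // _; rewrite /x chart_invK.
by rewrite E chart_mapK ?domE//; split=> //; apply: chart_map_cod; rewrite domE.
Qed.

Let B_A y : B (row_mx 0 y) -> A (row_mx 0 y).
Proof.
move=> By; have Dx := dom_c By; set x := chart_inv d _ in Dx.
have Sx : S x by rewrite SQ /= chart_inv_surface.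
have E : row_mx 0 y = chart_map c x.
  by case: cd => _ <- // _; rewrite /x chart_invK.
by rewrite E; exact: chart_map_cod.
Qed.

Let AB0 y : A (row_mx 0 y) <-> B (row_mx 0 y).
Proof. by split=> [/A_B[]//|]; exact: B_A. Qed.

Let psi0 y : B (row_mx 0 y) -> psi (row_mx 0 y) = row_mx 0 y.
Proof. by move=> /B_A Ay; rewrite /psi (A_B Ay).2 chart_invK. Qed.

(** Near y the two parametrizations of S coincide, hence so do their derivatives in tangential
    directions: both charts have the same frame, and the sign of [c] passes to [d]. *)
Let sign_d x : chart_dom d x -> S x -> o x (chart_frame d (chart_map d x)) = sigma.
Proof.
case: cd => _ mapE sg Dx Sx; have Dcx : chart_dom c x by rewrite -domE.
rewrite -(sg _ Dcx Sx) (mapE _ Dcx Sx).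
suff -> : chart_frame d (chart_map c x) = chart_frame c (chart_map c x) by [].
have Cx := chart_map_cod Dcx.
have Ex := chart_map_surface Dcx (SP0 Sx).
move: (rsubmx _) Ex => y Ex; rewrite Ex in Cx *.
have By := (A_B Cx).1.
apply/matrixP => i j.
have e1 := chart_frameE i j Cx.
have e2 := chart_frameE i j By.
apply: etrans; first exact: e2.
apply: etrans; last exact: (esym e1).
rewrite !pd_row_mx0; apply: near_pd.
have nA : \forall z \near y, A (row_mx 0 z).
  exact: row_mx0_continuous (open_near oA Cx).
by apply: filterS nA => z /A_B[_ ->].
Qed.

Let in_chart_weight (G : pt -> R) phi :
  in_chart c (fun x => G x * phi x) = fun u => G (chart_inv c u) * in_chart c phi u.
Proof.
apply/funext => u; rewrite !in_chartE.
case: (pselect (chart_cod c u)) => Cu; last by rewrite !pullback_out// mulr0.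
by rewrite !pullbackE// mulrA.
Qed.

(** [surface_integral_pullback] applied to the density of phi in the chart [c]. The weights, and the
    factor det b produced by the Jacobian, are functions of x read in [c] and return to the test
    function. *)
Lemma delta_in_matched_charts s (i : s.-tuple 'I_k) phi : test_in (chart_dom c) phi ->
  delta_in_chart o d i phi = \sum_(j : s.-tuple 'I_k) delta_in_chart o c j
    (fun x => \prod_(e < s) beta x (tnth i e) (tnth j e) * (\det (beta x) * phi x)).
Proof.
move=> tphi; have tF := test_in_in_chart tphi.
have tphid : test_in (chart_dom d) phi by rewrite domE.
have tG (j : s.-tuple 'I_k) : test_in (chart_dom c)
    (fun x => \prod_(e < s) beta x (tnth i e) (tnth j e) * (\det (beta x) * phi x)).
  have oU := @chart_dom_open _ _ _ _ c; have sU := smoothmxS (@subsetT _ (chart_dom c)) sbeta.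
  apply: (test_inM oU); first by apply: (smooth_prod oU) => e; exact: smooth_entry.
  by apply: (test_inM oU) => //; exact: smooth_det.
rewrite (delta_in_chart_sign SQ _ sign_d tphid).
(* Densities pull back functorially, and [chart_inv d] is [chart_inv c] after [psi]. *)
have -> : in_chart d phi = pullback B psi (in_chart c phi).
  rewrite !in_chartE; apply: (pullback_comp _ oA oB _ spsi psiA) => [|v Bv].
    exact: smooth_chart_inv.
  by rewrite inv_psi.
rewrite (surface_integral_pullback oA oB spsi schi psiA chiB psiK chiK sa sb ba1
  psi_normal chi_normal AB0 psi0 i tF).
have tH : test_in A (fun u => \det (b u) * in_chart c phi u).
  by apply: (test_inM oA) => //; exact: smooth_det.
rewrite (surface_integral_weighted_partials oA sb i tH) mulr_sumr mulr_sumr.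
apply: eq_bigr => j _; have [_ _ sg] := cd.
rewrite (delta_in_chart_sign SP _ sg (tG j)) !size_tuple.
by rewrite !in_chart_weight.
Qed.

End delta_matched.
End matched_charts.

(** * From local to global *)

Section test_function_facts.
Context {R : realType} {n : nat}.
Implicit Types f phi : 'rV[R]_n -> R.

Lemma test_in_test_function (A : set 'rV[R]_n) f :
  test_in A f -> test_function f /\ supp f `<=` A.
Proof.
move=> [[sf] [K [cK KA f0]]].
have sK : supp f `<=` K.
  have clK : closed K by apply: compact_closed cK; exact: norm_hausdorff.
  rewrite (closure_id K).1//; apply: closure_subset => x /= fx.
  by apply: contrapT => /f0 fx0; rewrite fx0 eqxx in fx.
split; last by move=> x /sK/KA.
by split=> //; apply: subclosed_compact cK sK; exact: closed_closure.
Qed.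

Lemma supp_outside f x : ~ supp f x -> f x = 0.
Proof.
by move=> sx; apply/eqP/negPn/negP => fx; apply: sx; exact: subset_closure.
Qed.

Lemma test_function_in phi : test_function phi -> test_in setT phi.
Proof.
by move=> [sf cf]; split; [exact: Smooth|exists (supp phi); split=> // x; exact: supp_outside].
Qed.

Lemma test_functionM (g : 'rV[R]_n -> R) phi : smooth setT g -> test_function phi ->
  test_function (fun x => g x * phi x) /\ supp (fun x => g x * phi x) `<=` supp phi.
Proof.
move=> sg /test_function_in tphi; split.
  by apply: (test_in_test_function (A := setT) _).1; exact: (test_inM openT).
by apply: closure_subset => x /=; apply: contra => /eqP ->; rewrite mulr0.
Qed.

End test_function_facts.

Lemma closed_zero_set (R : realType) n p (P : 'rV[R]_n -> 'rV[R]_p) :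
  smoothmx setT P -> closed [set x | P x = 0].
Proof.
move=> sP; rewrite -openC.
have -> : ~` [set x | P x = 0] = setT `&` P @^-1` (~` [set 0]).
  by apply/seteqP; split=> [x //|x []].
apply: open_preimage => //; first exact: openT.
rewrite openC; apply: accessible_closed_set1; apply: hausdorff_accessible.
exact: norm_hausdorff.
Qed.

Theorem theorem6p1 (R : realType) (k m : nat) (k_gt0 : (0 < k)%N)
    (P Q : 'rV[R]_(k + m) -> 'rV[R]_k)
    (alpha beta : 'rV[R]_(k + m) -> 'M[R]_k)
    (S : set 'rV[R]_(k + m))
    (P_smooth : smooth_mx_on setT P)
    (Q_smooth : smooth_mx_on setT Q)
    (alpha_smooth : smooth_mx_on setT alpha)
    (beta_smooth : smooth_mx_on setT beta)
    (SP : S = [set x | forall i, P x 0 i = 0])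
    (SQ : S = [set x | forall i, Q x 0 i = 0])
    (QE : forall x i, Q x 0 i = \sum_(j < k) P x 0 j * alpha x j i)
    (PE : forall x i, P x 0 i = \sum_(j < k) Q x 0 j * beta x j i)
    (alpha_beta : forall x j l,
       \sum_(i < k) alpha x j i * beta x i l = (j == l)%:R)
    (beta_alpha : forall x j l,
       \sum_(i < k) beta x j i * alpha x i l = (j == l)%:R)
    (gridP : correct_grid S P)
    (gridQ : correct_grid S Q)
    (o : orientation m S)
    (s : nat) (i : s.-tuple 'I_k)
    (deltaQ : functional R (k + m))
    (deltaP : s.-tuple 'I_k -> functional R (k + m))
    (deltaQ_spec : is_delta o Q i deltaQ)
    (deltaP_spec : forall j : s.-tuple 'I_k, is_delta o P j (deltaP j))
    (phi : 'rV[R]_(k + m) -> R) (phi_test : test_function phi) :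
  deltaQ phi =
  fmul (fun x => \det (beta x))
    (fun psi => \sum_(j : s.-tuple 'I_k)
       fmul (fun x => \prod_(a < s) beta x (tnth i a) (tnth j a))
         (deltaP j) psi) phi.
Proof.
have sP := Smoothmx P_smooth; have sQ := Smoothmx Q_smooth.
have salpha := Smoothmx alpha_smooth; have sbeta := Smoothmx beta_smooth.
have SP0 : S = [set x | P x = 0].
  rewrite SP; apply/seteqP; split=> x /= H; last by move=> l; rewrite H mxE.
  by apply/rowP => l; rewrite mxE.
have SQ0 : S = [set x | Q x = 0].
  rewrite SQ; apply/seteqP; split=> x /= H; last by move=> l; rewrite H mxE.
  by apply/rowP => l; rewrite mxE.
have QEx x : Q x = P x *m alpha x by apply/rowP => l; rewrite QE mxE.
have PEx x : P x = Q x *m beta x by apply/rowP => l; rewrite PE mxE.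
have ba x : beta x *m alpha x = 1%:M.
  by apply/matrixP => j l; rewrite !mxE beta_alpha.
(* The functions rho_a need to sum to 1 only near this set, which is compact because S is closed. *)
have cK : compact (S `&` supp phi).
  rewrite setIC; apply: compact_closedI; first by case: phi_test.
  by rewrite SP0; exact: closed_zero_set.
(* Indexing the pieces by matched pairs gives one partition of unity that is admissible for both P
   and Q, as the two charts of a pair have the same domain. *)
pose J := {q : adapted_chart P * adapted_chart Q * R | matched o q.1.1 q.1.2 q.2}.
have KD p : (S `&` supp phi) p ->
    exists2 q : J, open (chart_dom (sval q).1.1) & chart_dom (sval q).1.1 p.
  move=> [Sp _].
  have [c [d [sigma [cd cp]]]] := exists_matched_charts o sQ SP0 SQ0 gridP gridQ Sp.
  by exists (exist _ (c, d, sigma) cd) => //; exact: chart_dom_open.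
have [N [q [rho [V [rhoP oV KV rho1]]]]] := partition_of_unity cK KD.
pose c a := (sval (q a)).1.1; pose d a := (sval (q a)).1.2.
have cd a : matched o (c a) (d a) (sval (q a)).2 := svalP (q a).
have domE a : chart_dom (d a) = chart_dom (c a) by case: (cd a).
have trho a : test_in (chart_dom (c a)) (rho a) := (rhoP a).2.
have rhoc a : test_function (rho a) /\ supp (rho a) `<=` chart_dom (c a).
  exact: test_in_test_function.
have rhod a : test_function (rho a) /\ supp (rho a) `<=` chart_dom (d a).
  by rewrite domE.
rewrite (deltaQ_spec.2 phi phi_test N d rho V rhod oV KV rho1).
(* The whole weight for j, moved onto the test function. It does not enlarge the support, so the
   same neighbourhood V serves every j. *)
pose G j x := \prod_(e < s) beta x (tnth i e) (tnth j e) * \det (beta x).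
have sG j : smooth setT (G j).
  apply: (smoothM openT); last exact: (smooth_det openT).
  by apply: (smooth_prod openT) => e; exact: smooth_entry.
have deltaPE j : deltaP j (fun x => G j x * phi x) =
    \sum_(a < N) delta_in_chart o (c a) j (fun x => rho a x * (G j x * phi x)).
  have [tG sGphi] := test_functionM (sG j) phi_test.
  apply: ((deltaP_spec j).2 _ tG N c rho V rhoc oV _ rho1).
  by move=> x [Sx /sGphi sx]; apply: KV.
transitivity (\sum_(j : s.-tuple 'I_k) deltaP j (fun x => G j x * phi x)); last first.
  apply: eq_bigr => j _; apply: (congr1 (deltaP j)); apply/funext => x.
  by rewrite /G mulrA.
apply/esym; rewrite (eq_bigr _ (fun j _ => deltaPE j)) exchange_big /=; apply/esym.
apply: eq_bigr => a _.
have tphi : test_in (chart_dom (c a)) (fun x => rho a x * phi x).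
  have -> : (fun x => rho a x * phi x) = (fun x => phi x * rho a x).
    by apply/funext => x; rewrite mulrC.
  apply: (test_inM (@chart_dom_open _ _ _ _ (c a))) (trho a).
  by case: phi_test => sphi _; exact: smoothS (Smooth sphi).
rewrite (delta_in_matched_charts salpha sbeta SP0 SQ0 QEx PEx ba (cd a) i tphi).
apply: eq_bigr => j _; apply: (congr1 (delta_in_chart o (c a) j)).
by apply/funext => x; rewrite /G; ring.
Qed.
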